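(* Let $K$ be a field of characteristic zero, $R=K[x,y,z]$, and let $$I=(x^{\alpha+t},\,y^{\beta+t},\,z^{\gamma+t},\,x^{\alpha}y^{\beta}z^{\gamma}),$$ where $\alpha,\beta,\gamma,t$ are integers with $0<\alpha\le\beta\le\gamma\le 2(\alpha+\beta)$, $t\ge\frac13(\alpha+\beta+\gamma)$, and $\alpha+\beta+\gamma$ is divisible by three. Then $R/I$ has the weak Lefschetz property if one of the following conditions is satisfied: (i) $t$ and $\alpha+\beta+\gamma$ have the same parity; or (ii) $t$ is odd and $\alpha=\beta=\gamma$ is even.
   Context: An Artinian standard graded $K$-algebra $A$ has the weak Lefschetz property if there is a linear form $\ell\in[A]_1$ such that for all integers $j$ the multiplication map $\times\ell:[A]_j\to[A]_{j+1}$ has maximal rank (is injective or surjective). *)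

(* Defs.v *)
From HB Require Import structures.
From mathcomp Require Import all_boot all_order all_algebra.
From mathcomp Require Export ring_quotient.
From mathcomp Require Import boolp.
From mathcomp Require Export mpoly.

Set Implicit Arguments.
Unset Strict Implicit.
Unset Printing Implicit Defensive.

Import GRing.Theory.
Local Open Scope ring_scope.
Local Open Scope quotient_scope.

Definition in_span (R : comNzRingType) (gs : seq R) (f : R) : Prop :=
  exists c : 'I_(size gs) -> R, f = \sum_(i < size gs) c i * gs`_i.

(* The ideal generated by [gs]. The properness proof is carried only so that
   the library's [idealr] structure, hence [{ideal_quot _}], applies: that
   structure requires 1 to lie outside the ideal. *)
Definition ideal_gen (R : comNzRingType) (gs : seq R) (_ : ~ in_span gs 1) :
  {pred R} := fun f => `[< in_span gs f >].

Lemma ideal_gen_closed (R : comNzRingType) (gs : seq R) (h : ~ in_span gs 1) :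
  idealr_closed (ideal_gen h).
Proof.
split.
- apply/asboolP; exists (fun=> 0); rewrite big1 // => i _; exact: mul0r.
- by apply/asboolP.
- move=> a u v /asboolP [c ->] /asboolP [d ->]; apply/asboolP.
  exists (fun i => a * c i + d i).
  by rewrite mulr_sumr -big_split; apply: eq_bigr => i _; rewrite mulrDl mulrA.
Qed.

HB.instance Definition _ (R : comNzRingType) (gs : seq R)
    (h : ~ in_span gs 1) :=
  isIdealr.Build R (ideal_gen h) (ideal_gen_closed h).

(* The degree-[j] component of R/I, for R = K[x_1..x_n] and I homogeneous: the
   classes of the forms of degree [j]. *)
Definition quot_piece (K : fieldType) (n : nat) (I : idealr {mpoly K[n]})
    (j : nat) (a : {ideal_quot I}) : Prop :=
  exists2 f : {mpoly K[n]}, f \is j.-homog & a = \pi_{ideal_quot I} f.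

(* [piece j] is the homogeneous component [A]_j. Components of negative degree
   vanish, so the maps starting from them are injective and j : nat suffices. *)
Definition weak_Lefschetz (A : comPzRingType) (piece : nat -> A -> Prop) :
    Prop :=
  exists2 l : A, piece 1%N l &
    forall j : nat,
      (forall a b, piece j a -> piece j b -> l * a = l * b -> a = b) \/
      (forall b, piece j.+1 b -> exists2 a, piece j a & l * a = b).

Section Ideal.
Variables (K : fieldType) (alpha beta gamma t : nat).

Let x : {mpoly K[3]} := 'X_(@Ordinal 3 0 isT).
Let y : {mpoly K[3]} := 'X_(@Ordinal 3 1 isT).
Let z : {mpoly K[3]} := 'X_(@Ordinal 3 2 isT).

Definition acI_gens : seq {mpoly K[3]} :=
  [:: x ^+ (alpha + t); y ^+ (beta + t); z ^+ (gamma + t);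
      x ^+ alpha * y ^+ beta * z ^+ gamma].

Lemma acI_proper : (0 < alpha)%N -> (alpha <= beta)%N -> (beta <= gamma)%N ->
  ~ in_span acI_gens 1.
Proof.
move=> ha hab hbc [c].
have hb := leq_trans ha hab; have hc := leq_trans hb hbc.
move/(congr1 (mpoly.meval (fun=> 0))).
rewrite rmorph1 rmorph_sum big1 => [/eqP|i _]; first by rewrite oner_eq0.
suff e0 : all (fun g => g.@[fun=> 0] == 0) acI_gens.
  have /(_ _ (mem_nth 0 (ltn_ord i))) /eqP e := allP e0.
  by rewrite rmorphM /= e mulr0.
have e0 k (m : nat) : (0 < m)%N -> (('X_k : {mpoly K[3]}) ^+ m).@[fun=> 0] = 0.
  by move=> hm; rewrite rmorphXn /= mevalXU expr0n eqn0Ngt hm.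
by rewrite /= !e0 ?addn_gt0 ?ha ?hb ?hc // !rmorphM /= !e0 // !mulr0 eqxx.
Qed.

(* The ideal (x^(alpha+t), y^(beta+t), z^(gamma+t), x^alpha y^beta z^gamma). *)
Definition acI (ha : (0 < alpha)%N) (hab : (alpha <= beta)%N)
    (hbc : (beta <= gamma)%N) : idealr {mpoly K[3]} :=
  ideal_gen (acI_proper ha hab hbc).
End Ideal.

(* Main.v *)
Require Import Defs.
From mathcomp Require Import all_boot all_order all_algebra.
From mathcomp Require Import perm boolp zify ring lra.

Set Implicit Arguments.
Unset Strict Implicit.
Unset Printing Implicit Defensive.

(** Put s = (alpha + beta + gamma) / 3, m = t - s and d = 2 s + t. Reducing modulo
    the linear form x + y - z, the multiplication A_(d-2) -> A_(d-1) is bijective as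
    soon as every polynomial of degree < d in X is uniquely of the form
    g + X^(alpha+t) f + (1+X)^(gamma+t) h + X^alpha (1+X)^gamma p, with f, g, h, p of
    sizes 2s - alpha, 2s - beta, 2s - gamma, m. Injectivity in lower degrees then
    follows by multiplying by monomials, as the socle lives in high degree, and
    surjectivity in higher degrees is automatic. The sizes add up to d and the
    d x d matrix is integral, so it is enough to show over the rationals that a
    linear functional killing all these polynomials vanishes.

    If m is even, a determinant obtained from multiples of powers of 1 + X is
    positive: multiplication by 1 + X preserves nonnegativity of all minors, and so
    does adjoining two consecutive monomials X^u, X^(u+1).

    If m is odd and alpha = beta = gamma = a is even, the values of the functional
    on three half-lines around the hole x^a y^a z^a are related cyclically by the
    matrix B_a = (C(m+p+q, p)), p, q < a, so they give a vector u with B_a^3 u = u,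
    and B_a u = u since B_a is symmetrizable. For n odd, B_n is a product VW of
    involutions with det V = det W, which forces B_n to have the eigenvalue 1. By
    interlacing of B_(a-1) and B_a, a nonzero u would give a fixed vector of B_a
    with last coordinate 0. This is impossible: a perturbation of such a vector
    would have an image under B_a with more sign changes than itself, while B_a, a
    product of suffix summations, does not create sign changes. *)

Import Order.TTheory GRing.Theory Num.Theory.
Local Open Scope ring_scope.

(** * Sign changes and suffix sums *)

Section Alternation.
Variable F : realFieldType.
Implicit Types (b : bool) (s p q : seq F) (x y : F).

Definition has_sign b x := if b then 0 < x else x < 0.
Arguments has_sign : simpl never.

(** Some subsequence of [s] of length [k] has strictly alternating nonzero signs, the first being
    [b] ([true] for positive). For a nonzero [s] the largest such [k], over both [b], is the number
    of sign changes plus one. *)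
Fixpoint alternates_rec b k s : bool :=
  match k, s with
  | 0, _ => true
  | _.+1, [::] => false
  | k'.+1, x :: s' =>
      has_sign b x && alternates_rec (~~ b) k' s' || alternates_rec b k s'
  end.
Definition alternates := locked alternates_rec.

Lemma alternates0 b s : alternates b 0 s.
Proof. by rewrite /alternates -lock; case: s. Qed.
#[local] Hint Resolve alternates0 : core.

Lemma alternates_nil b k : alternates b k.+1 [::] = false.
Proof. by rewrite /alternates -lock. Qed.

Lemma alternatesS b k x s :
  alternates b k.+1 (x :: s) =
  has_sign b x && alternates (~~ b) k s || alternates b k.+1 s.
Proof. by rewrite /alternates -lock. Qed.

Lemma alternatesSP b k x s :
  reflect (has_sign b x /\ alternates (~~ b) k s \/ alternates b k.+1 s)
          (alternates b k.+1 (x :: s)).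
Proof.
rewrite alternatesS; apply: (iffP orP) => [[/andP [] //|]|[[-> ->]|->]];
  by [left|right].
Qed.

Lemma alternates_cons b k x s : alternates b k s -> alternates b k (x :: s).
Proof. by case: k => // k; rewrite alternatesS => ->; rewrite orbT. Qed.

Lemma alternates_prefix p s s' :
  (forall b k, alternates b k s -> alternates b k s') ->
  forall b k, alternates b k (p ++ s) -> alternates b k (p ++ s').
Proof.
move=> H; elim: p => //= x p IH b [//|k].
by rewrite !alternatesS => /orP [/andP [-> /IH ->]|/IH ->] //; rewrite orbT.
Qed.

Lemma alternates_size b k s : alternates b k s -> (k <= size s)%N.
Proof.
elim: s b k => [|x s IH] b [|k] //; first by rewrite alternates_nil.
by rewrite alternatesS => /orP [/andP [_ /IH] //|/IH]; apply: leqW.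
Qed.

Lemma has_signN b x : has_sign b x -> has_sign (~~ b) x = false.
Proof. by case: b => h; apply/negbTE; rewrite -leNgt ltW. Qed.

Lemma has_signD b x y : has_sign b (x + y) -> has_sign b x || has_sign b y.
Proof.
rewrite /has_sign; case: b => h.
  by have [//|hx] := ltP 0 x; have [//|hy] := ltP 0 y; lra.
by have [//|hx] := ltP x 0; have [//|hy] := ltP y 0; lra.
Qed.

Lemma alternates_other b k x s :
  has_sign b x -> alternates (~~ b) k (x :: s) -> alternates (~~ b) k s.
Proof. by move=> hx; case: k => // k; rewrite alternatesS (has_signN hx). Qed.

Lemma alternates_dup b k x s :
  alternates b k (x :: x :: s) -> alternates b k (x :: s).
Proof.
case: k => // k /alternatesSP [[h /(alternates_other h) h']|//].
by apply/alternatesSP; left.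
Qed.

(** The sign of [x + y] is already that of [x] or of [y], so an alternation through the sum can use
    a neighbour instead. *)
Lemma alternates_insert_sum b k x y s :
  alternates b k (x :: (x + y) :: y :: s) -> alternates b k (x :: y :: s).
Proof.
have key b' k' : alternates b' k' [:: x + y, y & s] ->
    alternates b' k' [:: x, y & s].
  case: k' => // k' /alternatesSP [[/has_signD /orP [hx|hy] h]|].
  - by apply/alternatesSP; left.
  - apply: alternates_cons; apply/alternatesSP; left; split=> //.
    exact: alternates_other hy h.
  - exact: alternates_cons.
case: k => // k /alternatesSP [[hx h]|]; last exact: key.
by apply/alternatesSP; left; split=> //; apply: alternates_other hx (key _ _ h).
Qed.

Fixpoint suffix_sums s :=
  if s is x :: s' then (x + head 0 (suffix_sums s')) :: suffix_sums s' else [::].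

(** Each suffix sum is x + y with y the next suffix sum, so inserting it between x and y creates no
    alternation. The prefix [p] collects the entries already passed. *)
Lemma alternates_suffix_sums p s b k :
  alternates b k (p ++ suffix_sums s) -> alternates b k (p ++ s).
Proof.
elim: s p b k => [//|x s IH] p b k /= h.
rewrite -cat_rcons; apply: IH; rewrite cat_rcons; apply: alternates_prefix h => {}b {}k.
case: (suffix_sums s) => [|y q] /=; first by rewrite addr0.
by move/(alternates_cons x)/alternates_insert_sum.
Qed.

Lemma alternates_head_suffix_sums p s b k :
  alternates b k (p ++ head 0 (suffix_sums s) :: suffix_sums s) ->
  alternates b k (p ++ s).
Proof.
case: s => [|x s] /=.
  apply: alternates_prefix => {}b {k} [|k] //; rewrite alternatesS alternates_nil.
  by case: b; rewrite /has_sign ltxx.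
move=> h; have {h} : alternates b k (p ++ suffix_sums (x :: s)).
  by apply: alternates_prefix h => {}b {}k /alternates_dup.
exact: alternates_suffix_sums.
Qed.

Definition suffix_heads N s := mkseq (fun i => head 0 (iter i.+1 suffix_sums s)) N.

Lemma suffix_headsS N s :
  suffix_heads N.+1 s = head 0 (suffix_sums s) :: suffix_heads N (suffix_sums s).
Proof.
rewrite /suffix_heads /mkseq /=; congr (_ :: _).
rewrite -[1%N]addn0 iotaDl -map_comp; apply: eq_map => i /=.
by rewrite -iterS iterSr -iterS.
Qed.

(** Each round emits the first suffix sum, which merely repeats the head of the list that the later
    rounds sum. *)
Lemma alternates_suffix_heads N p s b k :
  alternates b k (p ++ suffix_heads N s) -> alternates b k (p ++ s).
Proof.
elim: N p s => [|N IH] p s.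
  by apply: alternates_prefix => {}b {k} [|k] //; rewrite alternates_nil.
rewrite suffix_headsS -cat_rcons => /IH; rewrite cat_rcons.
exact: alternates_head_suffix_sums.
Qed.

Lemma alternates_nseq0 n s b k : alternates b k (nseq n 0 ++ s) -> alternates b k s.
Proof. 
elim: n => //= n IH; case: k IH => // k IH.
by rewrite alternatesS /has_sign ltxx if_same.
 Qed.

Lemma size_suffix_sums s : size (suffix_sums s) = size s.
Proof. by elim: s => //= x s ->. Qed.

Lemma suffix_sumsE s i : (suffix_sums s)`_i = \sum_(i <= j < size s) s`_j.
Proof.
elim: s i => [|x s IH] i; first by rewrite nth_nil big_geq.
case: i => [|i] /=; last by rewrite IH big_add1.
by rewrite big_nat_recl //= -nth0 IH.
Qed.

Lemma iter_suffix_sums_rec r s i : (i < size s)%N ->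
  (iter r.+1 suffix_sums s)`_i =
  (iter r suffix_sums s)`_i + (iter r.+1 suffix_sums s)`_i.+1.
Proof.
move=> hi; rewrite /= !suffix_sumsE big_ltn //.
by elim: r => //= r IH; rewrite size_suffix_sums.
Qed.

End Alternation.
#[local] Hint Resolve alternates0 : core.

(** * The matrix of binomials C(m + p + q, p) *)

(** Each row is the suffix sum of the preceding one, so row r + 1 is an (r + 1)-fold suffix sum of
    row 0. This serves both the iterated suffix sums of a list and the values of a functional around
    the hole. *)
Lemma pascal_array (R : nzRingType) (f : nat -> nat -> R) (L N : nat) :
  (forall r x, (r < N)%N -> (x < L)%N -> f r.+1 x = f r.+1 x.+1 + f r x) ->
  (forall r, (r < N)%N -> f r.+1 L = 0) ->
  forall r x, (r < N)%N -> (x <= L)%N ->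
    f r.+1 x = \sum_(j < L - x) 'C(r + j, r)%:R * f 0 (x + j)%N.
Proof.
move=> hrec h0; elim=> [|r IH] x hr.
  move: {2}(L - x)%N (erefl (L - x)%N) => n; elim: n x => [|n IHn] x hn hx.
    have -> : x = L by lia.
    by rewrite h0 // subnn big_ord0.
  rewrite hrec ?IHn //; [|lia..].
  have -> : (L - x = (L - x.+1).+1)%N by lia.
  rewrite big_ord_recl /= bin0 mul1r addn0 addrC; congr (_ + _).
  by apply: eq_bigr => i _; rewrite !bin0 addSnnS.
move: {2}(L - x)%N (erefl (L - x)%N) => n; elim: n x => [|n IHn] x hn hx.
  have -> : x = L by lia.
  by rewrite h0 // subnn big_ord0.
rewrite hrec ?IHn //; [|lia..].
rewrite IH //; [|lia..].
have -> : (L - x = (L - x.+1).+1)%N by lia.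
rewrite !big_ord_recl /= !addn0 !binn addrCA; congr (_ + _).
rewrite -big_split; apply: eq_bigr => i _ /=.
rewrite /bump !add1n !addnS !addSn -mulrDl -natrD; by congr (_%:R * _).
Qed.

Section Transfer.
Variables (F : realFieldType) (m : nat).
Implicit Types (a : nat) (u v w : nat -> F).

Definition transfer a w p : F := \sum_(q < a) 'C(m + p + q, p)%:R * w q.

(** With [m] zeros put in front of [w], entry [p] of the image is the first entry of the (p +
    1)-fold suffix sum, and suffix sums create no alternation. *)
Lemma alternates_transfer a w b k :
  alternates b k (mkseq (transfer a w) a) -> alternates b k (mkseq w a).
Proof.
move=> h; apply: (@alternates_nseq0 _ m); rewrite -[_ ++ _]cat0s.
apply: (@alternates_suffix_heads _ a); rewrite cat0s.
congr alternates: h; apply: eq_mkseq => p.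
set s := _ ++ _; rewrite -nth0.
have sz : size s = (m + a)%N by rewrite size_cat size_nseq size_mkseq.
rewrite (@pascal_array _ (fun r x => (iter r (@suffix_sums F) s)`_x) (m + a) p.+1) //=.
- rewrite subn0 big_split_ord /= big1 ?add0r => [|i _].
    apply: eq_bigr => q _; rewrite addnCA addnA add0n nth_cat size_nseq.
    by rewrite ltnNge leq_addr addKn nth_mkseq.
  by rewrite nth_cat size_nseq add0n ltn_ord nth_nseq ltn_ord mulr0.
- by move=> r x _ hx; rewrite addrC -iterS iter_suffix_sums_rec ?sz.
- move=> r _; apply: nth_default; rewrite size_suffix_sums.
  by elim: r => [|r IH] /=; rewrite ?size_suffix_sums ?sz.
Qed.

Lemma alternates_rcons b k (s : seq F) z :
  alternates b k s -> has_sign (b (+) odd k) z -> alternates b k.+1 (rcons s z).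
Proof.
elim: s b k => [|x s IH] b [|k] /=.
- by move=> _ hz; apply/alternatesSP; left; rewrite addbF in hz.
- by rewrite alternates_nil.
- by move=> _ hz; apply: alternates_cons; apply: IH.
- case/alternatesSP => [[hx h] hz|h hz]; apply/alternatesSP; [left|right].
    by split=> //; apply: IH => //; rewrite addNb -addbN.
  exact: IH.
Qed.

Lemma alternates_map_sign (g h : nat -> F) (r : seq nat) b k :
  (forall p, p \in r -> forall b, has_sign b (g p) -> has_sign b (h p)) ->
  alternates b k (map g r) -> alternates b k (map h r).
Proof.
elim: r b k => [|p r IH] b [|k] //= H.
have H' q : q \in r -> forall b, has_sign b (g q) -> has_sign b (h q).
  by move=> hq; apply: H; rewrite inE hq orbT.
case/alternatesSP=> [[h1 h2]|h1]; apply/alternatesSP; [left|right].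
  by split; [apply: H h1; rewrite inE eqxx|apply: IH].
exact: IH.
Qed.

Lemma small_positive (w h : nat -> F) N : (forall p, 0 < h p) ->
  exists2 e, 0 < e & forall p, (p < N)%N -> w p != 0 -> e * h p < `|w p|.
Proof.
move=> hpos; elim: N => [|N [e e0 IH]]; first by exists 1.
have [w0|wn0] := eqVneq (w N) 0.
  exists e => // p; rewrite ltnS leq_eqVlt => /orP [/eqP ->|]; last exact: IH.
  by rewrite w0 eqxx.
have hN : 0 < `|w N| / (2 * h N) by rewrite divr_gt0 ?normr_gt0 ?mulr_gt0.
exists (Num.min e (`|w N| / (2 * h N))); first by rewrite lt_min e0.
move=> p; rewrite ltnS leq_eqVlt => /orP [/eqP -> _|hp wp].
  apply: (@le_lt_trans _ _ (`|w N| / (2 * h N) * h N)).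
    by rewrite ler_pM2r // ge_min lexx orbT.
  have -> : `|w N| / (2 * h N) * h N = `|w N| / 2 by field; rewrite gt_eqF.
  by move: wn0; rewrite -normr_gt0; lra.
apply: le_lt_trans (IH p hp wp).
by rewrite ler_pM2r // ge_min lexx.
Qed.

Lemma has_sign_perturb b (x y : F) : `|y| < `|x| -> has_sign b (x + y) = has_sign b x.
Proof.
rewrite /has_sign; have [x0|x0] := ltP 0 x.
  rewrite (gtr0_norm x0) ltr_norml => /andP [h1 h2].
  by case: b; apply/idP/idP => //; lra.
rewrite (ler0_norm x0) ltr_norml => /andP [h1 h2].
by case: b; apply/idP/idP => //; lra.
Qed.

(** A small change of a nonzero [w l] keeps the signs of [w] and alters the image by a multiple of a
    positive column. The last entry of the image, formerly 0, then prolongs a longest alternation,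
    against [alternates_transfer]. *)
Lemma transfer_fixed_last a w :
  (forall p, (p < a.+1)%N -> transfer a.+1 w p = w p) -> w a = 0 ->
  forall p, (p < a.+1)%N -> w p = 0.
Proof.
move=> hfix wa0 l hl; apply/eqP; apply: contraT => wl0.
pose P k := [exists b, alternates b k (mkseq w a.+1)].
have exP : exists k, P k by exists 0%N; apply/existsP; exists true; apply: alternates0.
have boundP k : P k -> (k <= a.+1)%N.
  by case/existsP => b /alternates_size; rewrite size_mkseq.
case: (ex_maxnP exP boundP) => k /existsP [b hb] kmax.
have hb' : alternates b k (mkseq w a).
  move: hb; rewrite mkseqS wa0 -cats1 -[X in _ -> alternates _ _ X]cats0.
  apply: alternates_prefix => {}b {kmax} [|k'] //.
  by rewrite alternatesS alternates_nil /has_sign ltxx if_same.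
pose c p : F := 'C(m + p + l, p)%:R.
have c_pos p : 0 < c p by rewrite ltr0n bin_gt0 -addnA addnCA leq_addr.
(* The bound [c p + 1] controls both the change [e * c p] of the image and the change [e] of [w]
   itself. *)
have [e e0 he] := @small_positive w (fun p => c p + 1) a.+1
  (fun p => addr_gt0 (c_pos p) ltr01).
(* The sign that an appended entry needs in order to extend an alternation of length [k] starting
   with [b]. *)
pose tau : F := if b (+) odd k then 1 else -1.
have tau1 : `|tau| = 1 by rewrite /tau; case: ifP => _; rewrite ?normrN normr1.
pose w' q := w q + (if q == l then tau * e else 0).
have Bw' p : (p < a.+1)%N -> transfer a.+1 w' p = w p + tau * e * c p.
  move=> hp; rewrite -[w p]hfix // /transfer /w'.
  under eq_bigr do rewrite mulrDr.
  rewrite big_split /=; congr (_ + _).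
  rewrite (bigD1 (Ordinal hl)) //= eqxx big1 ?addr0 => [|i]; first exact: mulrC.
  by rewrite -val_eqE /= => /negbTE ->; rewrite mulr0.
have lt_c p : (p < a.+1)%N -> w p != 0 -> `|tau * e * c p| < `|w p|.
  move=> hp wp; apply: le_lt_trans (he p hp wp).
  rewrite !normrM tau1 mul1r (gtr0_norm e0) (gtr0_norm (c_pos p)).
  by rewrite ler_pM2l // lerDl.
have lt_e p : (p < a.+1)%N -> w p != 0 -> `|tau * e| < `|w p|.
  move=> hp wp; apply: le_lt_trans (he p hp wp).
  rewrite !normrM tau1 mul1r (gtr0_norm e0).
  by apply: ler_peMr; [exact: ltW|rewrite lerDr ltW].
have sign_neq0 b' (x : F) : has_sign b' x -> x != 0.
  by rewrite /has_sign; case: b' => h; [rewrite gt_eqF|rewrite lt_eqF].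
suff /kmax : P k.+1 by rewrite ltnn.
apply/existsP; exists b.
have step : alternates b k.+1 (mkseq w' a.+1).
  apply: alternates_transfer; rewrite mkseqS; apply: alternates_rcons.
    apply: alternates_map_sign hb' => p; rewrite mem_iota /= add0n => hp b' hs.
    have hp' : (p < a.+1)%N by apply: ltnW.
    by rewrite Bw' // has_sign_perturb // lt_c // (sign_neq0 b').
  rewrite Bw' // wa0 add0r /has_sign /tau; case: (_ (+) _).
    by rewrite mul1r mulr_gt0.
  by rewrite mulN1r mulNr oppr_lt0 mulr_gt0.
apply: alternates_map_sign step => p; rewrite mem_iota /= add0n => hp b'.
rewrite /w'; case: eqP => [->|_]; last by rewrite addr0.
by rewrite has_sign_perturb // lt_e.
Qed.

Lemma transferB a u v p :
  transfer a (fun q => u q - v q) p = transfer a u p - transfer a v p.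
Proof. by rewrite /transfer -sumrB; apply: eq_bigr => q _; rewrite mulrBr. Qed.

Lemma eq_transfer a u v p :
  (forall q, (q < a)%N -> u q = v q) -> transfer a u p = transfer a v p.
Proof. by move=> H; apply: eq_bigr => q _; rewrite H. Qed.

Definition weight p : F := p`!%:R / (m + p)`!%:R.

Lemma weight_gt0 p : 0 < weight p.
Proof. by rewrite divr_gt0 // ltr0n fact_gt0. Qed.

Definition weighted_form a u v := \sum_(p < a) weight p * (u p * v p).

(* [weight p * 'C(m + p + q, p) = (m + p + q)! / ((m + p)! (m + q)!)] is
   symmetric in [p] and [q]. *)
Lemma weighted_form_transfer a u v :
  weighted_form a u (transfer a v) = weighted_form a (transfer a u) v.
Proof.
rewrite /weighted_form /transfer.
under eq_bigr do rewrite !mulr_sumr.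
under [RHS]eq_bigr do rewrite mulr_suml mulr_sumr.
rewrite [RHS]exchange_big; apply: eq_bigr => p _; apply: eq_bigr => q _ /=.
have sym : weight p * 'C(m + p + q, p)%:R = weight q * 'C(m + q + p, q)%:R :> F.
  have fac r : (r`!%:R != 0 :> F) by rewrite pnatr_eq0 -lt0n fact_gt0.
  rewrite /weight.
  have E i j : 'C(m + i + j, i)%:R * (i`!%:R * (m + j)`!%:R) = (m + i + j)`!%:R :> F.
    have -> : (m + j = m + i + j - i)%N by lia.
    by rewrite -!natrM bin_fact //; lia.
  have := E p q; have := E q p.
  rewrite [in X in _ = X -> _](_ : m + q + p = m + p + q)%N; last lia.
  move=> Ep Eq; apply: (mulIf (fac (m + p)%N)); apply: (mulIf (fac (m + q)%N)).
  transitivity ((m + p + q)`!%:R : F); first by rewrite -Eq; field; exact: fac.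
  by rewrite -Ep; field; exact: fac.
rewrite [LHS](_ : _ = weight p * 'C(m + p + q, p)%:R * (u p * v q)); last by ring.
by rewrite sym; ring.
Qed.

(** Write B for the transfer. Then x = B u - u satisfies B^2 x + B x + x = 0. Pairing with x and
    using the symmetry of B gives a weighted sum of y^2 + x y + x^2 with y = B x, which is positive
    definite. *)
Lemma transfer_cube_fixed a u :
  (forall p, (p < a)%N -> transfer a (transfer a (transfer a u)) p = u p) ->
  forall p, (p < a)%N -> transfer a u p = u p.
Proof.
move=> h3.
pose x q := transfer a u q - u q; pose y := transfer a x.
have hy p : (p < a)%N -> transfer a y p + y p + x p = 0.
  move=> hp; rewrite /y /x.
  rewrite (@eq_transfer a _ (fun q => transfer a (transfer a u) q - transfer a u q));
    last by move=> q _; rewrite transferB.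
  rewrite !transferB h3 //; ring.
have : weighted_form a x (fun q => transfer a y q + y q + x q) = 0.
  by rewrite /weighted_form big1 // => p _; rewrite hy ?mulr0.
have -> : weighted_form a x (fun q => transfer a y q + y q + x q) =
    \sum_(p < a) weight p * (y p ^+ 2 + x p * y p + x p ^+ 2).
  have -> : weighted_form a x (fun q => transfer a y q + y q + x q) =
      weighted_form a x (transfer a y) + \sum_(p < a) weight p * (x p * y p + x p ^+ 2).
    by rewrite /weighted_form -big_split; apply: eq_bigr => p _ /=; ring.
  rewrite weighted_form_transfer -/y /weighted_form -big_split; apply: eq_bigr => p _ /=; ring.
have square (s r : F) : r ^+ 2 + s * r + s ^+ 2 = (r + s / 2) ^+ 2 + 3 / 4 * s ^+ 2.
  by field.
have nonneg (p : 'I_a) : 0 <= weight p * (y p ^+ 2 + x p * y p + x p ^+ 2).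
  rewrite square mulr_ge0 ?(ltW (weight_gt0 p)) //.
  by rewrite addr_ge0 ?sqr_ge0 // mulr_ge0 ?sqr_ge0 // divr_ge0 ?ler0n.
move/eqP; rewrite psumr_eq0 // => /allP H p hp.
have /H /= := mem_index_enum (Ordinal hp).
rewrite mulf_eq0 gt_eqF ?weight_gt0 //= => /eqP E.
suff /eqP : x p = 0 by rewrite subr_eq0 => /eqP.
have h34 : 0 <= 3 / 4 * x p ^+ 2 by rewrite mulr_ge0 ?sqr_ge0 // divr_ge0 ?ler0n.
move/eqP: E; rewrite square paddr_eq0 ?sqr_ge0 //.
by case/andP=> _; rewrite mulf_eq0 sqrf_eq0 mulf_eq0 invr_eq0 !pnatr_eq0 => /eqP.
Qed.

(** Extend [u] by a last coordinate 0. Symmetry paired with [v] shows that the last entry of [v] or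
    that of the image of the extension is 0. In the second case the extension is itself fixed, so
    [transfer_fixed_last] settles both. *)
Lemma transfer_fixed_interlace n u v :
  (forall p, (p < n)%N -> transfer n u p = u p) ->
  (forall p, (p < n.+1)%N -> transfer n.+1 v p = v p) ->
  (exists2 q, (q < n)%N & u q != 0) ->
  forall p, (p < n.+1)%N -> v p = 0.
Proof.
move=> hu hv [l hl ul].
pose u' q := if (q < n)%N then u q else 0.
have Bu' p : transfer n.+1 u' p = transfer n u p.
  rewrite /transfer big_ord_recr /= {2}/u' ltnn mulr0 addr0.
  by apply: eq_bigr => q _; rewrite /u' ltn_ord.
have form_eq w1 w2 w3 : (forall p, (p < n)%N -> w2 p = w3 p) ->
    weighted_form n.+1 w1 w2 - weighted_form n.+1 w1 w3 = weight n * (w1 n * (w2 n - w3 n)).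
  move=> E; rewrite /weighted_form !big_ord_recr /= addrAC opprD addrA.
  rewrite (eq_bigr (fun p : 'I_n => weight p * (w1 p * w3 p))) ?addrN.
    by ring.
  by move=> p _; rewrite E.
have : weighted_form n.+1 v (transfer n.+1 u') = weighted_form n.+1 v u'.
  rewrite weighted_form_transfer; apply: eq_bigr => p _.
  by rewrite hv.
move/eqP; rewrite -subr_eq0 form_eq => [|p hp]; last by rewrite Bu' hu // /u' hp.
rewrite mulf_eq0 gt_eqF ?weight_gt0 //= mulf_eq0 => /orP [/eqP vn0|].
  exact: transfer_fixed_last.
rewrite {2}/u' ltnn subr0 => /eqP un0.
have fix_u' p : (p < n.+1)%N -> transfer n.+1 u' p = u' p.
  rewrite ltnS leq_eqVlt => /orP [/eqP ->|hp]; first by rewrite un0 /u' ltnn.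
  by rewrite Bu' hu // /u' hp.
have := transfer_fixed_last fix_u' _ (ltnW hl).
by rewrite {1 2}/u' ltnn hl => /(_ erefl) u0; rewrite u0 eqxx in ul.
Qed.

(** The signed Pascal matrix is an involution: C(j, k) C(k, i) = C(j, i) C(j - i, k - i) reduces the
    sum to (1 - 1)^(j - i). *)
Lemma sum_sign_bin (N j i : nat) : (j < N)%N ->
  \sum_(k < N) (-1) ^+ k * 'C(j, k)%:R * 'C(k, i)%:R = (-1) ^+ i * (j == i)%:R :> F.
Proof.
move=> hj.
have [hij|hij] := ltnP j i.
  rewrite big1 => [|k _]; first by rewrite ltn_eqF // mulr0.
  have [hk|hk] := ltnP j k; first by rewrite (bin_small hk) mulr0 mul0r.
  by rewrite (@bin_small k) ?mulr0 //; apply: leq_ltn_trans hij.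
have -> : N = (i + (N - i))%N by lia.
rewrite big_split_ord /= big1 ?add0r => [|k _]; last by rewrite /= (@bin_small k) ?mulr0.
have E k : ('C(j, i + k) * 'C(i + k, i) = 'C(j, i) * 'C(j - i, k))%N.
  have [hk|hk] := leqP (i + k) j; last first.
    by rewrite !(@bin_small _ (_ + _)) ?(@bin_small (j - i)) ?muln0; lia.
  apply/eqP; rewrite -(eqn_pmul2r (fact_gt0 i)) -(eqn_pmul2r (fact_gt0 k)).
  rewrite -(eqn_pmul2r (fact_gt0 (j - i - k))); apply/eqP.
  transitivity j`!.
    rewrite -(bin_fact hk) -(bin_fact (leq_addr k i)) addKn subnDA; ring.
  rewrite -(bin_fact hij) -(@bin_fact (j - i) k); last lia; ring.
transitivity (\sum_(k < N - i)
    (-1) ^+ i * 'C(j, i)%:R * ((-1) ^+ k * 'C(j - i, k)%:R) : F).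
  by apply: eq_bigr => k _; rewrite /= -mulrA -natrM E natrM exprD; ring.
rewrite -mulr_sumr.
have -> : (N - i = (j - i).+1 + (N - j.+1))%N by lia.
rewrite big_split_ord /= [X in _ + X]big1 ?addr0 => [|k _]; last first.
  by rewrite bin_small ?mulr0 //; lia.
have -> : \sum_(k < (j - i).+1) (-1) ^+ k * 'C(j - i, k)%:R = (1 + -1) ^+ (j - i) :> F.
  by rewrite exprDn; apply: eq_bigr => k _; rewrite expr1n mul1r mulr_natr.
rewrite subrr expr0n subn_eq0.
have [->|ne] := eqVneq j i; first by rewrite leqnn binn !mulr1.
by rewrite leqNgt ltn_neqAle eq_sym ne hij !mulr0.
Qed.

Lemma transfer_odd_fixed n : odd n ->
  exists2 u, (forall p, (p < n)%N -> transfer n u p = u p) &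
    exists2 q, (q < n)%N & u q != 0.
Proof.
move=> n_odd.
(* [transfer n] is the product of two involutions of equal determinant. *)
pose V : 'M[F]_n := \matrix_(i, j) ((-1) ^+ j * 'C(m + i, m + j)%:R).
pose W : 'M[F]_n := \matrix_(i, j) ((-1) ^+ i * 'C(j, i)%:R).
have VV : V *m V = 1%:M.
  apply/matrixP => i j; rewrite !mxE.
  under eq_bigr do rewrite !mxE.
  have hi : (m + i < m + n)%N by rewrite ltn_add2l.
  have := sum_sign_bin (m + j) hi.
  rewrite big_split_ord /= big1 ?add0r => [|k _]; last first.
    by rewrite (@bin_small k) ?mulr0 // ltn_addr.
  under eq_bigr do rewrite exprD -2!mulrA.
  rewrite -mulr_sumr exprD -mulrA => /(mulfI _) H.
  transitivity ((-1) ^+ j * \sum_(i0 < n) (-1) ^+ i0 *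
    ('C(m + i, m + i0)%:R * 'C(m + i0, m + j)%:R) : F).
    by rewrite mulr_sumr; apply: eq_bigr => k _; ring.
  by rewrite H ?expf_neq0 ?oppr_eq0 ?oner_eq0 // mulrA -expr2 -exprM mulnC exprM
    sqrrN !expr1n mul1r eqn_add2l.
have WW : W *m W = 1%:M.
  apply/matrixP => i j; rewrite !mxE.
  under eq_bigr do rewrite !mxE.
  transitivity ((-1) ^+ i * \sum_(k < n) (-1) ^+ k * 'C(j, k)%:R * 'C(k, i)%:R : F).
    by rewrite mulr_sumr; apply: eq_bigr => k _; ring.
  rewrite sum_sign_bin // mulrA -expr2 -exprM mulnC exprM sqrrN !expr1n mul1r.
  by rewrite eq_sym.
(* The signs of [V] and [W] cancel, and C(m + i, m + k) = C(m + i, i - k) turns the sum into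
   Vandermonde's identity. *)
have VW i j : (V *m W) i j = 'C(m + i + j, i)%:R.
  rewrite !mxE; under eq_bigr do rewrite !mxE.
  rewrite [(_ + j)%N]addnC -binomial.Vandermonde natr_sum.
  have hn : n = (i.+1 + (n - i.+1))%N by rewrite subnKC.
  rewrite (eq_bigr (fun k : 'I_n => 'C(j, k)%:R * 'C(m + i, m + k)%:R)); last first.
    move=> k _; rewrite mulrACA -expr2 -exprM mulnC exprM sqrrN.
    by rewrite !expr1n mul1r mulrC.
  rewrite -(big_mkord predT (fun k => 'C(j, k)%:R * 'C(m + i, m + k)%:R)).
  rewrite (@big_cat_nat _ _ _ i.+1) ?ltn_ord //=.
  rewrite [X in _ + X]big_nat_cond [X in _ + X]big1 ?addr0; last first.
    by move=> k /andP [/andP [hk _] _]; rewrite (@bin_small (m + i)) ?mulr0 // ltn_add2l.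
  rewrite big_mkord; apply: eq_bigr => k _; rewrite natrM; congr (_ * _%:R).
  have hk : (k <= i)%N by rewrite -ltnS.
  by rewrite -bin_sub ?leq_add2l // subnDl.
have dV : \det V = \prod_(i < n) (-1) ^+ i.
  rewrite det_trig; first by apply: eq_bigr => i _; rewrite mxE binn mulr1.
  by apply/is_trig_mxP => i j hij; rewrite mxE bin_small ?mulr0 // ltn_add2l.
have dW : \det W = \prod_(i < n) (-1) ^+ i.
  rewrite -det_tr det_trig; first by apply: eq_bigr => i _; rewrite !mxE binn mulr1.
  by apply/is_trig_mxP => i j hij; rewrite !mxE bin_small ?mulr0.
(* Both V (V - W) and - (V - W) W equal 1 - V W. As [n] is odd and the determinants of [V] and [W]
   agree, the determinant equals its own opposite. *)
have /eqP : \det (1%:M - V *m W) = 0.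
  have e1 : \det (1%:M - V *m W) = \det V * \det (V - W).
    by rewrite -det_mulmx mulmxBr VV.
  have e2 : \det (1%:M - V *m W) = - (\det (V - W) * \det W).
    rewrite -det_mulmx mulmxBl WW -[V *m W - _]opprB -[- (1%:M - _)]scaleN1r detZ -signr_odd n_odd.
    by rewrite mulN1r opprK.
  have : \det (1%:M - V *m W) + \det (1%:M - V *m W) = 0.
    by rewrite {1}e1 e2 dV dW mulrC addrN.
  by rewrite -mulr2n => /eqP; rewrite mulrn_eq0 => /eqP.
rewrite -det_tr => /det0P [v v0 hv].
exists (fun q => if insub q is Some i then v 0 i else 0).
  move=> p hp; pose i := Ordinal hp.
  have := congr1 (fun A : 'M_(_, _) => A 0 i) hv.
  rewrite linearB /= trmx1 mulmxBr mulmx1 !mxE => /eqP; rewrite subr_eq0 => /eqP.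
  have sub (q : 'I_n) : (if insub (val q) is Some i0 then v 0 i0 else 0) = v 0 q.
    by rewrite valK.
  rewrite -[p]/(val i) sub => ->; apply: eq_bigr => q _.
  by rewrite sub [(_^T) _ _]mxE VW mulrC.
have [i vi] : exists i, v 0 i != 0.
  apply/existsP; apply: contraT; rewrite negb_exists => /forallP H.
  case/eqP: v0; apply/rowP => i; rewrite mxE; apply/eqP.
  by have := H i; rewrite negbK.
by exists (val i); rewrite ?ltn_ord // valK.
Qed.

Lemma transfer_even_fixed n v : ~~ odd n ->
  (forall p, (p < n)%N -> transfer n v p = v p) ->
  forall p, (p < n)%N -> v p = 0.
Proof.
case: n => // n /=; rewrite negbK => n_odd hv.
by have [u hu u0] := transfer_odd_fixed n_odd; apply: transfer_fixed_interlace hu hv u0.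
Qed.

End Transfer.

(** * The symmetric case *)

(* The value on X^i (1 + X)^k of the linear functional sending X^l to [c l]. *)
Definition moment (R : nzRingType) (c : nat -> R) (i k : nat) : R :=
  \sum_(l < k.+1) 'C(k, l)%:R * c (i + l)%N.

Lemma moment0 (R : nzRingType) (c : nat -> R) i : moment c i 0 = c i.
Proof. by rewrite /moment big_ord1 mul1r addn0. Qed.

Lemma momentS (R : nzRingType) (c : nat -> R) i k :
  moment c i k.+1 = moment c i k + moment c i.+1 k.
Proof.
rewrite /moment big_ord_recl /= bin0.
under eq_bigr do rewrite /bump /= add1n binS natrD mulrDl.
rewrite big_split /= addrA; congr (_ + _); last first.
  by apply: eq_bigr => l _; rewrite addnS.
rewrite [X in _ + X]big_ord_recr /= bin_small // mul0r addr0.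
by rewrite [in RHS]big_ord_recl bin0; congr (_ + _).
Qed.

Lemma moment_eq0 (R : nzRingType) (c : nat -> R) i k :
  (forall l, (l <= k)%N -> c (i + l)%N = 0) -> moment c i k = 0.
Proof. by move=> H; rewrite /moment big1 // => l _; rewrite H ?mulr0 // -ltnS. Qed.

Section Sectors.
Variables (F : realFieldType) (a m : nat).
Hypotheses (a_even : ~~ odd a) (m_odd : odd m).

(* [G i j k] stands for the value on x^i y^j z^k, with x + y + z = 0, of a linear
   functional on the forms of degree i + j + k = 3a + m - 1 which vanishes on the
   ideal. *)
Record balanced (G : nat -> nat -> nat -> F) : Prop := Balanced {
  balanced_sum : forall i j k, (i + j + k).+2 = (3 * a + m)%N ->
    G i.+1 j k + G i j.+1 k + G i j k.+1 = 0;
  balanced_far : forall i j k, (i + j + k).+1 = (3 * a + m)%N ->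
    [|| 2 * a + m <= i, 2 * a + m <= j | 2 * a + m <= k]%N -> G i j k = 0;
  balanced_hole : forall i j k, (i + j + k).+1 = (3 * a + m)%N ->
    (a <= i)%N -> (a <= j)%N -> (a <= k)%N -> G i j k = 0 }.

Definition rotate (G : nat -> nat -> nat -> F) i j k := G j k i.

Lemma balanced_rotate G : balanced G -> balanced (rotate G).
Proof.
case=> h1 h2 h3; split=> i j k e.
- by rewrite /rotate -addrA addrC h1 //; lia.
- by move=> h; apply: h2; [lia|case/or3P: h => ->; rewrite ?orbT].
- by move=> *; apply: h3 => //; lia.
Qed.

(* The values along the half-line leaving the hole x^a y^a z^a at a corner. The
   recursion carries the values on one of the three half-lines to the next one by
   [transfer]. *)
Definition ray (G : nat -> nat -> nat -> F) q :=
  (-1) ^+ q * G (a + m + q)%N a (a - q.+1)%N.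

Section Sector.
Variables (G : nat -> nat -> nat -> F) (hG : balanced G).

(** Coordinates on the sector with i >= a >= j: [r] is the distance below y^a and [x] the distance
    beyond x^a. The sign turns [balanced_sum] into the recurrence of [pascal_array]. *)
Let row r x := (-1) ^+ (x + r) * G (a + x)%N (a - r)%N (a + m + r - x.+1)%N.

Lemma rowE r x : (r < a)%N -> (x <= a + m)%N ->
  row r.+1 x = \sum_(j < a + m - x) 'C(r + j, r)%:R * row 0 (x + j)%N.
Proof.
apply: (@pascal_array _ row) => {}r; last first.
  by move=> hr; rewrite /row (balanced_far hG) ?mulr0 //; lia.
move=> {}x hr hx; rewrite /row.
have := @balanced_sum _ hG (a + x) (a - r.+1) (a + m + r - x.+1).
have -> : (a + m + r.+1 - x.+1 = (a + m + r - x.+1).+1)%N by lia.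
have -> : (a - r = (a - r.+1).+1)%N by lia.
have -> : (a + m + r.+1 - x.+2 = a + m + r - x.+1)%N by lia.
move=> H; have /H/eqP : (a + x + (a - r.+1) + (a + m + r - x.+1)).+2 = (3 * a + m)%N by lia.
rewrite addr_eq0 => /eqP; rewrite !addnS !addSn !exprS => E.
by rewrite -[G (a + x)%N _ _.+1]opprK -E; ring.
Qed.

Lemma row0_hole x : (x < m)%N -> row 0 x = 0.
Proof. by move=> hx; rewrite /row (balanced_hole hG) ?mulr0 //; lia. Qed.

Lemma row0_ray q : (q < a)%N -> row 0 (m + q) = - ray G q.
Proof.
move=> hq; rewrite /row /ray addn0 exprD -signr_odd m_odd mulN1r mulNr.
by rewrite subn0 addn0 addnA; congr (- (_ * G _ _ _)); lia.
Qed.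

(** Column 0 of the array is the next half-line. In row 0 the first [m] entries lie in the hole and
    vanish, and the others are the ray up to sign. *)
Lemma ray_rotate p : (p < a)%N -> ray (rotate G) p = transfer m a (ray G) p.
Proof.
move=> hp; have := rowE hp (leq0n _).
rewrite subn0 addnC big_split_ord /= big1 ?add0r => [|j _]; last first.
  by rewrite /= add0n row0_hole ?mulr0.
under eq_bigr => q _ do rewrite row0_ray // mulrN addnCA addnA.
rewrite sumrN /row add0n addn0 exprS mulN1r mulNr => /oppr_inj E; rewrite /transfer -E.
by rewrite /ray /rotate; congr (_ * G _ _ _); lia.
Qed.

Lemma sector_eq0 : (forall q, (q < a)%N -> ray G q = 0) ->
  forall i j k, (i + j + k).+1 = (3 * a + m)%N -> (a <= i)%N -> (j <= a)%N ->
  G i j k = 0.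
Proof.
move=> h0 i j k e hi hj.
have row0 x : (x < a + m)%N -> row 0 x = 0.
  move=> hx; have [/row0_hole //|hm] := ltnP x m.
  by rewrite -(subnKC hm) row0_ray ?h0 ?oppr0 //; lia.
have [hf|hf] := leqP (2 * a + m) i; first by rewrite (balanced_far hG) ?hf.
suff : row (a - j) (i - a) = 0.
  move/eqP; rewrite /row mulf_eq0 expf_eq0 oppr_eq0 oner_eq0 andbF /=.
  rewrite subnKC // subKn // => /eqP <-; congr (G _ _ _); lia.
case: (a - j)%N (leq_subr j a) => [|r] hr; first by rewrite row0 //; lia.
rewrite rowE; [|lia..]; rewrite big1 // => l _.
by rewrite row0 ?mulr0 //; have := ltn_ord l; lia.
Qed.
End Sector.

Lemma balanced_eq0 G : balanced G ->
  forall i j k, (i + j + k).+1 = (3 * a + m)%N -> G i j k = 0.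
Proof.
move=> hG; have hG1 := balanced_rotate hG; have hG2 := balanced_rotate hG1.
(* Three rotations give back [G], so the cube of the transfer fixes [ray G]. *)
have fixed p : (p < a)%N -> transfer m a (ray G) p = ray G p.
  apply: transfer_cube_fixed => {}p hp.
  rewrite -[RHS]/(ray (rotate (rotate (rotate G))) p) (ray_rotate hG2) //.
  apply: eq_transfer => q hq; rewrite (ray_rotate hG1) //.
  by apply: eq_transfer => q' hq'; rewrite (ray_rotate hG).
have ray0 p : (p < a)%N -> ray G p = 0 by apply: transfer_even_fixed a_even fixed _.
have ray1 p : (p < a)%N -> ray (rotate G) p = 0.
  move=> hp; rewrite (ray_rotate hG) // /transfer big1 // => q _.
  by rewrite ray0 ?mulr0.
have ray2 p : (p < a)%N -> ray (rotate (rotate G)) p = 0.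
  move=> hp; rewrite (ray_rotate hG1) // /transfer big1 // => q _.
  by rewrite ray1 ?mulr0.
move=> i j k e.
have s0 := sector_eq0 hG ray0 e.
have s1 : (a <= j)%N -> (k <= a)%N -> G i j k = 0.
  by move=> ? ?; apply: (sector_eq0 hG2 ray2 (i := j) (j := k) (k := i)) => //; lia.
have s2 : (a <= k)%N -> (i <= a)%N -> G i j k = 0.
  by move=> ? ?; apply: (sector_eq0 hG1 ray1 (i := k) (j := i) (k := j)) => //; lia.
(* The hole and the three sectors cover all exponents: three exponents below [a] have too small a
   sum. *)
have [hi|hi] := leqP a i; have [hj|hj] := leqP a j; have [hk|hk] := leqP a k.
- exact: (balanced_hole hG).
- by apply: s1 => //; apply: ltnW.
- by apply: s0 => //; apply: ltnW.
- by apply: s0 => //; apply: ltnW.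
- by apply: s2 => //; apply: ltnW.
- by apply: s1 => //; apply: ltnW.
- by apply: s2 => //; apply: ltnW.
- lia.
Qed.

Lemma moments_eq0_symmetric (c : nat -> F) : (0 < a)%N ->
  (forall k, (k < a)%N -> c k = 0) ->
  (forall k, (2 * a + m <= k)%N -> c k = 0) ->
  (forall i, (i < a)%N -> moment c i (2 * a + m) = 0) ->
  (forall i, (i < m)%N -> moment c (a + i) a = 0) ->
  forall k, c k = 0.
Proof.
move=> a0 c_lo c_hi hfar hhole.
(* Only the least power of 1 + X is given; [momentS] raises it while lowering the range of [i]. The
   same happens for [hole]. *)
have far k i : (2 * a + m <= k)%N -> (i + k < 3 * a + m)%N -> moment c i k = 0.
  elim: k i => [|k IH] i hk hik; first lia.
  move: hk; rewrite leq_eqVlt => /orP [/eqP ek|hk]; first by rewrite -ek; apply: hfar; lia.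
  by rewrite momentS !IH ?addr0 //; lia.
have hole k i : (a <= k)%N -> (a <= i)%N -> (i + k < 2 * a + m)%N -> moment c i k = 0.
  elim: k i => [|k IH] i hk hi hik; first lia.
  move: hk; rewrite leq_eqVlt => /orP [/eqP ek|hk].
    by rewrite -ek -(subnKC hi); apply: hhole; lia.
  by rewrite momentS !IH ?addr0 //; lia.
(* The substitution x = X, y = 1, z = -(1 + X), for which x + y + z = 0. *)
pose G i (j : nat) k := (-1) ^+ k * moment c i k.
have hG : balanced G.
  split=> i j k e.
  - by rewrite /G momentS exprS; ring.
  - case/or3P => h; rewrite /G.
    + by rewrite moment_eq0 ?mulr0 // => l _; apply: c_hi; lia.
    + by rewrite moment_eq0 ?mulr0 // => l hl; apply: c_lo; lia.
    + by rewrite far ?mulr0 //; lia.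
  - by move=> *; rewrite /G hole ?mulr0 //; lia.
move=> k; have [hk|hk] := leqP (2 * a + m) k; first exact: c_hi.
have : G k (3 * a + m - k.+1)%N 0%N = 0 by apply: (balanced_eq0 hG); lia.
by rewrite /G mul1r moment0.
Qed.
End Sectors.

(** * Minors and the case of an even hole *)

Lemma coef_Xn_binomial (R : comNzRingType) n i k :
  ('X^i * (1 + 'X) ^+ n : {poly R})`_k = if (k < i)%N then 0 else 'C(n, k - i)%:R.
Proof.
rewrite coefXnM; case: ifP => // _; rewrite exprDn.
under eq_bigr => j _ do rewrite expr1n mul1r.
rewrite coef_sum; have [h|h] := ltnP (k - i) n.+1.
  rewrite (bigD1 (Ordinal h)) //= coefMn coefXn eqxx big1 ?addr0 // => j.
  by rewrite -val_eqE coefMn coefXn eq_sym /= => /negbTE ->; rewrite mul0rn.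
rewrite bin_small // big1 // => j _; rewrite coefMn coefXn gtn_eqF ?mul0rn //.
exact: leq_trans (ltn_ord j) h.
Qed.

Lemma moment_pairing (R : comNzRingType) (c : nat -> R) N i n : (i + n < N)%N ->
  \sum_(k < N) ('X^i * (1 + 'X) ^+ n : {poly R})`_k * c k = moment c i n.
Proof.
move=> h; have -> : N = (i + (n.+1 + (N - (i + n.+1))))%N by lia.
rewrite big_split_ord /= big1 ?add0r => [|k _]; last first.
  by rewrite coef_Xn_binomial ltn_ord mul0r.
rewrite big_split_ord /= [X in _ + X]big1 ?addr0 => [|k _]; last first.
  by rewrite coef_Xn_binomial ifN ?bin_small ?mul0r //; lia.
by apply: eq_bigr => k _; rewrite coef_Xn_binomial ltnNge leq_addr addKn.
Qed.

Section Minors.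
Variable F : realFieldType.
Implicit Types (n : nat) (g h : nat -> {poly F}).

Definition minor n g (s : 'I_n -> nat) : F := \det (\matrix_(i, j) (g i)`_(s j)).

Definition increasing n (s : 'I_n -> nat) := forall i j : 'I_n, (i < j)%N -> (s i < s j)%N.

(** Only the minors using all of the first [n] rows enter, with columns at arbitrary increasing
    exponents. *)
Definition nonneg_minors n g := forall s : 'I_n -> nat, increasing s -> 0 <= minor g s.

Lemma increasing_leq n (s : 'I_n -> nat) (i j : 'I_n) :
  increasing s -> (i <= j)%N -> (s i + (j - i) <= s j)%N.
Proof.
move=> hs; case: j => j hj /=; elim: j hj => [|j IH] hj hij.
  have -> : i = Ordinal hj by apply: val_inj => /=; lia.
  by rewrite subnn addn0.
move: hij; rewrite leq_eqVlt => /orP [/eqP e|hij].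
  have -> : i = Ordinal hj by apply: val_inj.
  by rewrite subnn addn0.
have := IH (ltnW hj) hij; have := hs (Ordinal (ltnW hj)) (Ordinal hj) (ltnSn j); lia.
Qed.

Lemma det_eq_col n (A : 'M[F]_n) (i j : 'I_n) :
  i != j -> (forall k, A k i = A k j) -> \det A = 0.
Proof.
by move=> hij E; rewrite -det_tr; apply: (determinant_alternate hij) => k; rewrite !mxE.
Qed.

Lemma det_col0 n (A : 'M[F]_n) (j : 'I_n) : (forall k, A k j = 0) -> \det A = 0.
Proof. by move=> E; rewrite (expand_det_col _ j) big1 // => k _; rewrite E mul0r. Qed.

(** Multilinearity in the columns: [f] records the summand taken in each column. *)
Lemma det_sum_cols n (A B : 'M[F]_n) :
  \det (A + B) = \sum_(f : {ffun 'I_n -> bool})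
    \det (\matrix_(i, j) (if f j then A i j else B i j)).
Proof.
rewrite -det_tr [LHS]/determinant.
under [RHS]eq_bigr do rewrite -det_tr /determinant.
rewrite exchange_big; apply: eq_bigr => s _ /=; rewrite -big_distrr /=; congr (_ * _).
rewrite (eq_bigr (fun i => \sum_(b : bool) (if b then A (s i) i else B (s i) i))).
  rewrite bigA_distr_bigA; apply: eq_bigr => f _.
  by apply: eq_bigr => i _; rewrite !mxE.
by move=> i _; rewrite !mxE big_bool.
Qed.

Definition shifted n (f : {ffun 'I_n -> bool}) (s : 'I_n -> nat) j := (s j - f j)%N.

Lemma minor_mul1X n g s : minor (fun i => (1 + 'X) * g i) s =
  \sum_(f : {ffun 'I_n -> bool})
    \det (\matrix_(i, j) (if f j then ('X * g i)`_(s j) else (g i)`_(s j)) : 'M_n).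
Proof.
rewrite /minor.
have -> : \matrix_(i, j) ((1 + 'X) * g i)`_(s j) =
    \matrix_(i, j) ('X * g i)`_(s j) + \matrix_(i, j) (g i)`_(s j) :> 'M_n.
  by apply/matrixP => i j; rewrite !mxE mulrDl mul1r coefD addrC.
rewrite det_sum_cols; apply: eq_bigr => f _; congr (\det _).
by apply/matrixP => i j; rewrite !mxE.
Qed.

Lemma minor_term_shifted n g s (f : {ffun 'I_n -> bool}) :
  (forall j, f j -> (0 < s j)%N) ->
  \det (\matrix_(i, j) (if f j then ('X * g i)`_(s j) else (g i)`_(s j)) : 'M_n) =
  minor g (shifted f s).
Proof.
move=> hf; congr (\det _); apply/matrixP => i j; rewrite !mxE /shifted.
case: ifP => [fj|_]; last by rewrite subn0.
by rewrite coefXM gtn_eqF ?hf // subn1.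
Qed.

(** Multiplication by X lowers a column exponent by one. A lowered exponent 0 gives a zero column;
    otherwise either two columns coincide or the exponents still increase strictly. *)
Lemma minor_term_ge0 n g s (f : {ffun 'I_n -> bool}) :
  nonneg_minors n g -> increasing s ->
  0 <= \det (\matrix_(i, j) (if f j then ('X * g i)`_(s j) else (g i)`_(s j)) : 'M_n).
Proof.
move=> hg hs.
have [/forallP hf|] := boolP [forall j, f j ==> (0 < s j)%N]; last first.
  rewrite negb_forall => /existsP [j]; rewrite negb_imply -eqn0Ngt => /andP [fj /eqP s0].
  by rewrite (@det_col0 _ _ j) // => i; rewrite mxE fj s0 coefXM.
rewrite minor_term_shifted => [|j fj]; last exact: (implyP (hf j)).
have [/existsP [i /existsP [j /andP [hij /eqP e]]]|] :=
    boolP [exists i : 'I_n, exists j : 'I_n, (i < j)%N && (shifted f s i == shifted f s j)].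
  rewrite /minor (@det_eq_col _ _ i j) //; first by rewrite -val_eqE /= ltn_eqF.
  by move=> k; rewrite !mxE e.
rewrite negb_exists => /forallP H; apply: hg => i j hij.
move: (H i); rewrite negb_exists => /forallP /(_ j); rewrite hij /= /shifted.
have := hs i j hij; move: (hf j); case: (f i) (f j) => [] [] /=; lia.
Qed.

Lemma nonneg_minors_mul1X n g :
  nonneg_minors n g -> nonneg_minors n (fun i => (1 + 'X) * g i).
Proof.
by move=> hg s hs; rewrite minor_mul1X sumr_ge0 // => f _; apply: minor_term_ge0.
Qed.

Lemma nonneg_minors_mul1Xn n g N :
  nonneg_minors n g -> nonneg_minors n (fun i => (1 + 'X) ^+ N * g i).
Proof.
move=> hg; elim: N => [|N IH] s hs.
  have := hg s hs; congr (_ <= \det _); apply/matrixP => i j.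
  by rewrite !mxE expr0 mul1r.
have := nonneg_minors_mul1X IH hs; congr (_ <= \det _); apply/matrixP => i j.
by rewrite !mxE exprS mulrA.
Qed.

(** Each factor 1 + X can move the columns up by at most one. The columns max(a, b - 1) come one
    step before [b]; their positive minor is one term of the expansion, and the other terms are
    nonnegative. *)
Lemma minor_mul1Xn_gt0 n g N (a b : 'I_n -> nat) : nonneg_minors n g ->
  increasing a -> increasing b -> 0 < minor g a ->
  (forall j, (a j <= b j <= a j + N)%N) ->
  0 < minor (fun i => (1 + 'X) ^+ N * g i) b.
Proof.
move=> hg ha; elim: N b => [|N IH] b hb ga hab.
  move: ga; congr (_ < \det _); apply/matrixP => i j; rewrite !mxE expr0 mul1r.
  by congr (_ `_ _); have := hab j; lia.
pose a' j := maxn (a j) (b j).-1.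
have ha' : increasing a'.
  move=> i j hij; have := ha i j hij; have := hb i j hij; rewrite /a'.
  have := hab i; have := hab j; lia.
have {IH ga} pos : 0 < minor (fun i => (1 + 'X) ^+ N * g i) a'.
  by apply: IH => // j; have := hab j; rewrite /a'; lia.
have -> : minor (fun i => (1 + 'X) ^+ N.+1 * g i) b =
    minor (fun i => (1 + 'X) * ((1 + 'X) ^+ N * g i)) b.
  by congr (\det _); apply/matrixP => i j; rewrite !mxE exprS mulrA.
rewrite minor_mul1X (bigD1 [ffun j => (a' j < b j)%N]) //=.
rewrite ltr_wpDr ?sumr_ge0 // => [f _|].
  by apply: (@minor_term_ge0 _ (fun i => (1 + 'X) ^+ N * g i)) => //; apply: nonneg_minors_mul1Xn.
rewrite (@minor_term_shifted _ (fun i => (1 + 'X) ^+ N * g i)) => [|j]; last first.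
  by rewrite ffunE; apply: leq_ltn_trans.
move: pos; congr (_ < \det _); apply/matrixP => i j; rewrite !mxE; congr (_ `_ _).
by rewrite /shifted ffunE; have := hab j; rewrite /a'; lia.
Qed.

Lemma minor_unit n h u (s : 'I_n.+1 -> nat) (q : 'I_n.+1) : h n = 'X^u ->
  increasing s -> s q = u ->
  minor h s = (-1) ^+ (n + q) * minor h (s \o lift q).
Proof.
move=> hn hs sq; rewrite /minor (expand_det_row _ ord_max) (bigD1 q) //=.
rewrite big1 ?addr0 => [|j jq]; last first.
  rewrite mxE hn coefXn; case: eqP => [e|_]; last by rewrite mul0r.
  have := jq; rewrite -val_eqE neq_ltn => /orP [/hs|/hs]; lia.
rewrite mxE hn coefXn sq eqxx mul1r /cofactor; congr (_ * \det _).
by apply/matrixP => i j; rewrite !mxE lift_max.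
Qed.

Lemma minor_unit0 n h u (s : 'I_n.+1 -> nat) : h n = 'X^u ->
  (forall q, s q != u) -> minor h s = 0.
Proof.
move=> hn hs; rewrite /minor (expand_det_row _ ord_max) big1 // => j _.
by rewrite mxE hn coefXn (negbTE (hs j)) mul0r.
Qed.

Lemma increasing_lift n (s : 'I_n.+1 -> nat) q : increasing s -> increasing (s \o lift q).
Proof. by move=> hs i j hij; apply: hs; rewrite /= ltnNge leq_bump2 -ltnNge. Qed.

(* A single monomial row would contribute a sign depending on the position of its
   column; for two consecutive monomials the signs cancel. *)
Lemma minor_unit_pair n h u (s : 'I_n.+2 -> nat) (q : 'I_n.+2) (p : 'I_n.+1) :
  h n = 'X^u -> h n.+1 = 'X^(u.+1) -> increasing s -> s q = u.+1 ->
  s (lift q p) = u -> minor h s = minor h (s \o lift q \o lift p).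
Proof.
move=> hn hn1 hs sq sp.
rewrite (minor_unit hn1 hs sq) (minor_unit hn (increasing_lift q hs) sp) mulrA -exprD.
have lt_pq : (lift q p < q)%N.
  have := neq_lift q p; rewrite eq_sym -val_eqE neq_ltn => /orP [//|/hs]; lia.
have ep : lift q p = p :> nat by move: lt_pq; rewrite /= /bump; case: leqP => //=; lia.
have := increasing_leq hs (ltnW lt_pq); rewrite sp sq ep in lt_pq * => hpq.
have eq : q = p.+1 :> nat by lia.
have -> : (n.+1 + q + (n + p) = (n + p).+1.*2)%N by lia.
by rewrite -signr_odd odd_double mul1r.
Qed.

Lemma nonneg_minors_unit_pair n h u : h n = 'X^u -> h n.+1 = 'X^(u.+1) ->
  nonneg_minors n h -> nonneg_minors n.+2 h.
Proof.
move=> hn hn1 hh s hs.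
have [/existsP [q /eqP sq]|] := boolP [exists q, s q == u.+1]; last first.
  by rewrite negb_exists => /forallP /(minor_unit0 hn1) ->.
have [/existsP [p /eqP sp]|] := boolP [exists p, (s \o lift q) p == u]; last first.
  rewrite negb_exists => /forallP /(minor_unit0 hn) e.
  by rewrite (minor_unit hn1 hs sq) e mulr0.
rewrite (minor_unit_pair hn hn1 hs sq sp); apply: hh.
by do 2 apply: increasing_lift.
Qed.

Lemma minor_monomials n (s : 'I_n -> nat) :
  (forall j, s j = j) -> minor (fun i => 'X^i) s = 1.
Proof.
move=> hs; rewrite -(det1 F n) /minor; congr (\det _).
by apply/matrixP => i j; rewrite !mxE coefXn hs eq_sym.
Qed.

(** Increasing columns below [n] are forced to be the identity, and a column at [n] or beyond is
    zero. *)
Lemma nonneg_minors_monomials n : nonneg_minors n (fun i => 'X^i).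
Proof.
move=> s hs; have [/existsP [j hj]|] := boolP [exists j, (n <= s j)%N].
  rewrite /minor (@det_col0 _ _ j) // => i; rewrite mxE coefXn gtn_eqF //.
  exact: leq_trans (ltn_ord i) hj.
rewrite negb_exists => /forallP H; rewrite minor_monomials // => j.
have n0 : (0 < n)%N by apply: leq_ltn_trans (ltn_ord j).
have hlast : (n.-1 < n)%N by rewrite prednK.
have h1 := @increasing_leq _ s (Ordinal n0) j hs (leq0n _).
have h2 : (j <= Ordinal hlast)%N by have := ltn_ord j; rewrite /=; lia.
have := increasing_leq hs h2; have := H (Ordinal hlast); have := ltn_ord j.
by move: h1 => /=; lia.
Qed.

End Minors.

(** * Nonsingularity when [m] is even *)

Section EvenHole.
Variables (F : realFieldType) (al be ga s m : nat).
Hypotheses (hs : (3 * s = al + be + ga)%N) (hab : (al <= be)%N) (hbc : (be <= ga)%N)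
  (hc : (ga <= 2 * s)%N) (m_even : ~~ odd m).

Let c := (2 * s - ga)%N.
Let k0 := minn al c.

(** The two families of generators containing a power of 1 + X, with the common factor (1 + X)^ga
    removed. *)
Let rows i : {poly F} :=
  if (i < c)%N then (1 + 'X) ^+ (s + m) * 'X^i else 'X^(al + (i - c)).

(* Columns at which the minor of the first [c + 2e] rows is positive: the powers
   (1 + X)^(s+m) X^i, i < c, use exponents avoiding the interval [al, al + m), and
   the monomials X^(al+i) use that interval. *)
Let cols e j : nat :=
  if (j < k0)%N then j else if (j < k0 + e.*2)%N then (al + (j - k0))%N
  else (j - e.*2 + m)%N.

Lemma increasing_cols e n : (e.*2 <= m)%N -> n = (e.*2 + c)%N ->
  increasing (fun j : 'I_n => cols e j).
Proof.
move=> he -> i j hij; rewrite /cols /k0; have := ltn_ord j; have := ltn_ord i.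
by repeat case: ifP; lia.
Qed.

Lemma rows_minors e : (e.*2 <= m)%N ->
  nonneg_minors (e.*2 + c) rows /\ 0 < minor rows (fun j : 'I_(e.*2 + c) => cols e j).
Proof.
have mono := @nonneg_minors_monomials F.
elim: e => [|e IH] he.
  rewrite double0 add0n; split=> [t ht|].
    have := nonneg_minors_mul1Xn (s + m) (mono c) ht.
    by congr (_ <= \det _); apply/matrixP => i j; rewrite !mxE /rows ltn_ord.
  have H : 0 < minor (fun i => (1 + 'X) ^+ (s + m) * 'X^i : {poly F}) (fun j : 'I_c => cols 0 j).
    apply: (@minor_mul1Xn_gt0 _ _ (fun i => 'X^i) _ (@nat_of_ord c)) => //.
    - exact: increasing_cols.
    - by rewrite minor_monomials.
    - by move=> j; rewrite /cols /k0; have := ltn_ord j; repeat case: ifP; lia.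
  move: H; congr (_ < \det _); apply/matrixP => i j.
  by rewrite !mxE /rows ltn_ord.
have he' : (e.*2 <= m)%N by lia.
have [nn pos] := IH he'.
have r1 : rows (e.*2 + c) = 'X^(al + e.*2).
  by rewrite /rows ifN ?addnK // -leqNgt leq_addl.
have r2 : rows (e.*2 + c).+1 = 'X^((al + e.*2).+1).
  by rewrite /rows; case: ifP => [|_]; [lia|congr ('X^_); lia].
split; first exact: nonneg_minors_unit_pair r1 r2 nn.
have hk0 : (k0 + e.*2 < (e.*2 + c).+1)%N by rewrite /k0; lia.
(* Deleting the columns k0 + 2e and k0 + 2e + 1 of [cols e.+1] leaves [cols e]. *)
pose p := Ordinal hk0; pose q : 'I_(e.*2 + c).+2 := Ordinal (hk0 : (p.+1 < (e.*2 + c).+2)%N).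
have sq : cols e.+1 q = (al + e.*2).+1.
  by rewrite /cols /=; repeat case: ifP; lia.
have sp : cols e.+1 (lift q p) = (al + e.*2)%N.
  by rewrite /cols /= /bump; repeat case: ifP; lia.
have inc := @increasing_cols e.+1 (e.*2 + c).+2 he erefl.
rewrite (minor_unit_pair r1 r2 inc sq sp).
move: pos; congr (_ < \det _); apply/matrixP => i j; rewrite !mxE; congr (_ `_ _).
rewrite /= /cols /bump; have := ltn_ord j; rewrite /k0.
by repeat case: ifP; lia.
Qed.

Lemma rows_minor_gt0 :
  0 < minor (fun i => (1 + 'X) ^+ ga * rows i) (fun j : 'I_(m + c) => (2 * s - be + j)%N).
Proof.
have em : (m./2.*2 = m)%N by have := odd_double_half m; rewrite (negbTE m_even).
have [nn pos] := @rows_minors m./2 (eq_leq em).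
rewrite em in nn pos; apply: (minor_mul1Xn_gt0 nn _ _ pos).
- by apply: increasing_cols; rewrite em.
- by move=> i j; rewrite ltn_add2l.
- move=> j; rewrite /cols /k0 em; have := ltn_ord j; rewrite /c.
  by repeat case: ifP; lia.
Qed.

(** The support of [f] lies in the window from 2s - be up to al + s + m, of length m + c. The m + c
    remaining conditions form a square system whose determinant is that of [rows_minor_gt0]. *)
Lemma moments_eq0_even_hole (f : nat -> F) :
  (forall k, (k < 2 * s - be)%N -> f k = 0) ->
  (forall k, (al + (s + m) <= k)%N -> f k = 0) ->
  (forall i, (i < 2 * s - ga)%N -> moment f i (ga + (s + m)) = 0) ->
  (forall i, (i < m)%N -> moment f (al + i) ga = 0) ->
  forall k, f k = 0.
Proof.
move=> f_lo f_hi hfar hhole.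
set lo := (2 * s - be)%N in f_lo *.
have supp (P : nat -> F) :
    \sum_(k < 2 * s + s + m) P k * f k = \sum_(j < m + c) P (lo + j)%N * f (lo + j)%N.
  have -> : (2 * s + s + m = lo + ((m + c) + (2 * s - al)))%N by rewrite /lo /c; lia.
  rewrite big_split_ord /= big1 ?add0r => [|k _]; last by rewrite f_lo ?mulr0.
  rewrite big_split_ord /= [X in _ + X]big1 ?addr0 // => k _.
  by rewrite f_hi ?mulr0 // /lo /c; lia.
pose A : 'M[F]_(m + c) := \matrix_(i, j) ((1 + 'X) ^+ ga * rows i)`_(lo + j).
have Af : A *m (\col_j f (lo + j)%N) = 0.
  apply/matrixP => i j; rewrite [RHS]mxE mxE.
  under eq_bigr do rewrite !mxE.
  rewrite -(supp (fun k => ((1 + 'X) ^+ ga * rows i)`_k)) /rows.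
  have hi := ltn_ord i; case: ifP => hic.
    rewrite mulrA -exprD mulrC moment_pairing; last (have ec : c = (2 * s - ga)%N by []; lia).
    exact: hfar.
  rewrite mulrC moment_pairing; last (have ec : c = (2 * s - ga)%N by []; lia).
  by apply: hhole; lia.
have A_unit : A \in unitmx.
  by rewrite unitmxE unitfE; apply: lt0r_neq0; apply: rows_minor_gt0.
have col0 : \col_(j < m + c) f (lo + j)%N = 0.
  by rewrite -(mulKmx A_unit (\col_j _)) Af mulmx0.
move=> k; have [hk|hk] := ltnP k lo; first exact: f_lo.
have [hk2|hk2] := leqP (al + (s + m)) k; first exact: f_hi.
have hj : (k - lo < m + c)%N by rewrite /lo /c; lia.
have := congr1 (fun M : 'cV_(m + c) => M (Ordinal hj) 0) col0.
by rewrite !mxE /= subnKC.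
Qed.
End EvenHole.

(** * The univariate decomposition *)

Section Univariate.
Variables (al be ga s m : nat).
Hypotheses (hs : (3 * s = al + be + ga)%N) (hab : (al <= be)%N) (hbc : (be <= ga)%N)
  (hc : (ga <= 2 * s)%N) (ha : (0 < al)%N).
Hypothesis hcase : ~~ odd m \/ [/\ odd m, al = be, be = ga & ~~ odd al].

Let n1 := (2 * s - al)%N.
Let n2 := (2 * s - be)%N.
Let n3 := (2 * s - ga)%N.
Let d := (n2 + n1 + n3 + m)%N.

(** The generators come in blocks of sizes n2, n1, n3, m: multiples by powers of X of 1, X^(al + s +
    m), (1 + X)^(ga + s + m) and X^al (1 + X)^ga. *)
Let exp_X r : nat :=
  if (r < n2)%N then r else if (r < n2 + n1)%N then (al + (s + m) + (r - n2))%N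
  else if (r < n2 + n1 + n3)%N then (r - (n2 + n1))%N
  else (al + (r - (n2 + n1 + n3)))%N.

Let exp_1X r : nat :=
  if (r < n2 + n1)%N then 0%N else if (r < n2 + n1 + n3)%N then (ga + (s + m))%N else ga.

Definition generator (R : comNzRingType) r : {poly R} := 'X^(exp_X r) * (1 + 'X) ^+ exp_1X r.

Definition generator_mx (R : comNzRingType) : 'M[R]_d := \matrix_(r, k) (generator R r)`_k.

Lemma generator_mx_map (R S : comNzRingType) (f : {rmorphism R -> S}) :
  map_mx f (generator_mx R) = generator_mx S.
Proof.
apply/matrixP => r k; rewrite !mxE !coef_Xn_binomial.
by case: ifP => _; rewrite ?rmorph0 ?rmorph_nat.
Qed.

Lemma generator_size r : (r < d)%N -> (exp_X r + exp_1X r < d)%N.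
Proof. by rewrite /exp_X /exp_1X /d /n1 /n2 /n3 => ?; repeat case: ifP; lia. Qed.

Lemma moments_eq0 (F : realFieldType) (f : nat -> F) :
  (forall k, (k < n2)%N -> f k = 0) ->
  (forall k, (al + (s + m) <= k)%N -> f k = 0) ->
  (forall i, (i < n3)%N -> moment f i (ga + (s + m)) = 0) ->
  (forall i, (i < m)%N -> moment f (al + i) ga = 0) ->
  forall k, f k = 0.
Proof.
case: hcase => [m_even|[m_odd e1 e2 al_even]]; first exact: moments_eq0_even_hole.
have es : s = al by lia.
rewrite /n2 /n3 es -{}e2 -e1 => f_lo f_hi h1 h2.
have e : (2 * al - al = al)%N by lia.
rewrite e in f_lo h1; have e3 : (al + (al + m) = 2 * al + m)%N by lia.
by rewrite e3 in f_hi h1; apply: (moments_eq0_symmetric al_even m_odd ha).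
Qed.

(** A kernel vector is read as a functional [f], zero on X^k for k >= d. It kills every generator,
    so [moments_eq0] applies. *)
Lemma det_generator_mx_rat : \det (generator_mx rat) != 0.
Proof.
rewrite -det_tr; apply/det0P => -[v v0 hv].
pose f k : rat := if insub k is Some i then v 0 i else 0.
have fE (i : 'I_d) : f i = v 0 i by rewrite /f valK.
have f_gen r : (r < d)%N -> moment f (exp_X r) (exp_1X r) = 0.
  move=> hr; rewrite -(moment_pairing _ (generator_size hr)).
  have := congr1 (fun A : 'rV_d => A 0 (Ordinal hr)) hv; rewrite !mxE => e.
  by rewrite -[RHS]e; apply: eq_bigr => k _; rewrite fE !mxE mulrC.
have f0 : forall k, f k = 0.
  apply: moments_eq0.
  - move=> k hk; have := @f_gen k; rewrite /exp_X /exp_1X hk ltn_addr // moment0; apply.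
    by rewrite /d; lia.
  - move=> k hk; have [hkd|hkd] := ltnP k d; last by rewrite /f insubN // -leqNgt.
    have := @f_gen (n2 + (k - (al + (s + m))))%N; rewrite /exp_X /exp_1X.
    have h1 : (n2 + (k - (al + (s + m))) < n2 + n1)%N.
      by move: hkd; rewrite /d /n1 /n2 /n3; lia.
    rewrite ifN; last by rewrite -leqNgt leq_addr.
    rewrite h1 addKn subnKC // moment0; apply.
    by rewrite /d; lia.
  - move=> i hi; have := @f_gen (n2 + n1 + i)%N; rewrite /exp_X /exp_1X.
    have -> : (n2 + n1 + i < n2)%N = false by lia.
    have -> : (n2 + n1 + i < n2 + n1)%N = false by lia.
    rewrite ltn_add2l hi addKn; apply.
    by rewrite /d; lia.
  - move=> i hi; have := @f_gen (n2 + n1 + n3 + i)%N; rewrite /exp_X /exp_1X.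
    have -> : (n2 + n1 + n3 + i < n2)%N = false by lia.
    have -> : (n2 + n1 + n3 + i < n2 + n1)%N = false by lia.
    have -> : (n2 + n1 + n3 + i < n2 + n1 + n3)%N = false by lia.
    by rewrite addKn; apply; rewrite /d; lia.
by case/eqP: v0; apply/rowP => i; rewrite mxE -fE f0.
Qed.

Section Field.
Variable (K : fieldType).
Hypothesis charK0 : [pchar K] =i pred0.

(** The determinant is the image of an integer, which is nonzero because its image in the rationals
    is; characteristic zero keeps it nonzero in [K]. *)
Lemma generator_mx_unit : generator_mx K \in unitmx.
Proof.
rewrite unitmxE unitfE -(generator_mx_map (intr : {rmorphism int -> K})) det_map_mx.
have := det_generator_mx_rat.
rewrite -(generator_mx_map (intr : {rmorphism int -> rat})) det_map_mx intr_eq0.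
move/pcharf0P: charK0 => char0 /=.
by case: (\det _) => n; rewrite ?NegzE ?rmorphN ?oppr_eq0 /= -pmulrn char0.
Qed.

(** Image of an element of the ideal under x = X, y = 1, z = 1 + X. The generator y^(be + t) becomes
    1, so its cofactor [g] stands alone. *)
Definition combination (g f h p : {poly K}) : {poly K} :=
  g + 'X^(al + (s + m)) * f + (1 + 'X) ^+ (ga + (s + m)) * h + 'X^al * (1 + 'X) ^+ ga * p.

Lemma generator_sum (c : nat -> K) :
  \sum_(r < d) c r *: generator K r =
  combination (\poly_(i < n2) c i) (\poly_(i < n1) c (n2 + i)%N)
    (\poly_(i < n3) c (n2 + n1 + i)%N) (\poly_(i < m) c (n2 + n1 + n3 + i)%N).
Proof.
rewrite /d !big_split_ord /= /combination; congr (_ + _ + _ + _);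
  rewrite poly_def ?mulr_sumr; apply: eq_bigr => i _;
  rewrite -?scalerAr; congr (_ *: _); rewrite /generator /exp_X /exp_1X.
- by rewrite ltn_ord ltn_addr // expr0 mulr1.
- rewrite ltnNge leq_addr ltn_add2l ltn_ord addKn /= expr0 mulr1 exprD //.
- have -> : (n2 + n1 + i < n2)%N = false by lia.
  have -> : (n2 + n1 + i < n2 + n1)%N = false by lia.
  by rewrite ltn_add2l ltn_ord addKn mulrC.
- have -> : (n2 + n1 + n3 + i < n2)%N = false by lia.
  have -> : (n2 + n1 + n3 + i < n2 + n1)%N = false by lia.
  have -> : (n2 + n1 + n3 + i < n2 + n1 + n3)%N = false by lia.
  by rewrite addKn exprD mulrAC.
Qed.

Lemma combination_eq0 (g f h p : {poly K}) : (size g <= n2)%N -> (size f <= n1)%N ->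
  (size h <= n3)%N -> (size p <= m)%N -> combination g f h p = 0 ->
  [/\ g = 0, f = 0, h = 0 & p = 0].
Proof.
move=> sg sf sh sp e.
have trunc n (q : {poly K}) : (size q <= n)%N -> \poly_(i < n) q`_i = q.
  move=> sq; apply/polyP => i; rewrite coef_poly; case: ltnP => // hi.
  by rewrite nth_default // (leq_trans sq).
pose c r := if (r < n2)%N then g`_r else if (r < n2 + n1)%N then f`_(r - n2)
  else if (r < n2 + n1 + n3)%N then h`_(r - (n2 + n1)) else p`_(r - (n2 + n1 + n3)).
have cg : \poly_(i < n2) c i = g.
  by rewrite -[RHS](trunc n2) //; apply/polyP => i; rewrite !coef_poly /c; case: (i < n2)%N.
have cf : \poly_(i < n1) c (n2 + i)%N = f.
  rewrite -[RHS](trunc n1) //; apply/polyP => i; rewrite !coef_poly /c; case: ifP => // hi.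
  by rewrite ltnNge leq_addr ltn_add2l hi addKn.
have ch : \poly_(i < n3) c (n2 + n1 + i)%N = h.
  rewrite -[RHS](trunc n3) //; apply/polyP => i; rewrite !coef_poly /c; case: ifP => // hi.
  do 2 (rewrite ifN; last by rewrite -leqNgt; lia).
  by rewrite ltn_add2l hi addKn.
have cp : \poly_(i < m) c (n2 + n1 + n3 + i)%N = p.
  rewrite -[RHS](trunc m) //; apply/polyP => i; rewrite !coef_poly /c; case: ifP => // hi.
  do 3 (rewrite ifN; last by rewrite -leqNgt; lia).
  by rewrite addKn.
have c0 r : (r < d)%N -> c r = 0.
  move=> hr; have : \row_(r < d) c r *m generator_mx K = 0.
    apply/rowP => k; rewrite !mxE -[RHS](coef0 K k) -[in RHS]e.
    rewrite -[in RHS]cg -[in RHS]cf -[in RHS]ch -[in RHS]cp -generator_sum coef_sum.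
    by apply: eq_bigr => r' _; rewrite !mxE coefZ.
  move=> /(congr1 (mulmxr (invmx (generator_mx K)))).
  rewrite /= mulmxK ?generator_mx_unit // mul0mx.
  by move/rowP/(_ (Ordinal hr)); rewrite !mxE.
have poly0 n k : (n + k <= d)%N -> \poly_(i < k) c (n + i)%N = 0 :> {poly K}.
  by move=> hk; apply/polyP => i; rewrite coef_poly coef0; case: ifP => // hi; apply: c0; lia.
split.
- by rewrite -cg (poly0 0%N) // /d; lia.
- by rewrite -cf poly0 // /d; lia.
- by rewrite -ch poly0 // /d; lia.
- by rewrite -cp poly0 // /d; lia.
Qed.

Lemma combination_surj (q : {poly K}) : (size q <= d)%N ->
  exists g f h p : {poly K}, [/\ (size g <= n2)%N, (size f <= n1)%N, (size h <= n3)%N,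
    (size p <= m)%N & q = combination g f h p].
Proof.
move=> sq.
have [v hv] : exists v, v *m generator_mx K = \row_(k < d) q`_k.
  by exists ((\row_(k < d) q`_k) *m invmx (generator_mx K)); rewrite mulmxKV ?generator_mx_unit.
pose c r := if insub r is Some i then v 0 i else 0.
exists (\poly_(i < n2) c i), (\poly_(i < n1) c (n2 + i)%N),
  (\poly_(i < n3) c (n2 + n1 + i)%N), (\poly_(i < m) c (n2 + n1 + n3 + i)%N).
split; last first.
  rewrite -generator_sum; apply/polyP => k; rewrite coef_sum.
  have [hk|hk] := ltnP k d; last first.
    rewrite nth_default ?(leq_trans sq) // big1 // => r _.
    rewrite coefZ coef_Xn_binomial; have := generator_size (ltn_ord r) => hr.
    by rewrite ifN ?bin_small ?mulr0 //; lia.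
  move/rowP/(_ (Ordinal hk)): hv; rewrite !mxE => <-.
  by apply: eq_bigr => r _; rewrite coefZ /c valK mxE.
all: exact: size_poly.
Qed.
End Field.
End Univariate.

(** * Homogeneous polynomials in three variables *)

Section Forms.
Variable K : fieldType.
Implicit Types (f g u v : {mpoly K[3]}) (q : {poly K}).

Let i0 : 'I_3 := @Ordinal 3 0 isT.
Let i1 : 'I_3 := @Ordinal 3 1 isT.
Let i2 : 'I_3 := @Ordinal 3 2 isT.

Definition monomial a b c : 'X_{1..3} := (U_(i0) *+ a + U_(i1) *+ b + U_(i2) *+ c)%MM.

Lemma monomial_eta (e : 'X_{1..3}) : e = monomial (e i0) (e i1) (e i2).
Proof.
apply/mnmP => i; rewrite !mnmDE !mulmnE !mnm1E.
by case: i => [[|[|[|i]]] hi] //=; rewrite ?mul1n ?mul0n ?add0n ?addn0; congr (e _);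
  apply: val_inj.
Qed.

Lemma monomialE a b c : [/\ monomial a b c i0 = a, monomial a b c i1 = b &
  monomial a b c i2 = c].
Proof. by split; rewrite !mnmDE !mulmnE !mnm1E /= ?mul1n ?mul0n ?add0n ?addn0. Qed.

Lemma mdeg_monomial a b c : mdeg (monomial a b c) = (a + b + c)%N.
Proof. by rewrite !mdegD !mdegMn !mdeg1 !mul1n. Qed.

Lemma monomialD a b c a' b' c' :
  (monomial a b c + monomial a' b' c')%MM = monomial (a + a') (b + b') (c + c').
Proof.
have [e1 e2 e3] := monomialE a b c; have [e1' e2' e3'] := monomialE a' b' c'.
by rewrite [LHS]monomial_eta !(mnmDE _ (monomial a b c)) e1 e2 e3 e1' e2' e3'.
Qed.

Lemma mpolyX_monomial a b c :
  'X_[monomial a b c] = 'X_i0 ^+ a * 'X_i1 ^+ b * 'X_i2 ^+ c :> {mpoly K[3]}.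
Proof. by rewrite !mpolyXD -!mpolyXn. Qed.

(* [form n f] says that [f] is homogeneous of degree [n - 1]; [form 0] is [0]. *)
Definition form n f := forall e, f@_e != 0 -> (mdeg e).+1 = n.

Lemma form_dhomog n f : f \is n.-homog <-> form n.+1 f.
Proof.
split=> [/dhomogP H e|H]; first by rewrite -mcoeff_msupp => /H ->.
by apply/dhomogP => e; rewrite mcoeff_msupp => /H [].
Qed.

Lemma form_zero n : form n 0.
Proof. by move=> e; rewrite mcoeff0 eqxx. Qed.

Lemma formD n f g : form n f -> form n g -> form n (f + g).
Proof.
move=> hf hg e; rewrite mcoeffD; have [fe|/hf //] := eqVneq f@_e 0.
by rewrite fe add0r; apply: hg.
Qed.

Lemma formZ n c f : form n f -> form n (c *: f).
Proof. by move=> hf e; rewrite mcoeffZ mulf_eq0 negb_or => /andP [_ /hf]. Qed.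

Lemma formN n f : form n f -> form n (- f).
Proof. by move=> hf; rewrite -scaleN1r; apply: formZ. Qed.

Lemma form_X e : form (mdeg e).+1 'X_[e].
Proof. by move=> e'; rewrite mcoeffX; case: (e =P e') => [-> //|_]; rewrite eqxx. Qed.

Lemma monomial_ind (P : {mpoly K[3]} -> Prop) f :
  P 0 -> (forall u v, P u -> P v -> P (u + v)) -> (forall c u, P u -> P (c *: u)) ->
  (forall e, f@_e != 0 -> P 'X_[e]) -> P f.
Proof.
move=> P0 PD PZ PX; rewrite [f]mpolyE big_seq; apply: big_ind => // e.
by rewrite mcoeff_msupp => /PX; apply: PZ.
Qed.

Lemma formMX n f e : form n f -> form (n + mdeg e) ('X_[e] * f).
Proof.
move=> hf; apply: (@monomial_ind (fun u => form (n + mdeg e) ('X_[e] * u))).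
- by rewrite mulr0; apply: form_zero.
- by move=> u v; rewrite mulrDr; apply: formD.
- by move=> c u; rewrite -scalerAr; apply: formZ.
- move=> e' /hf <-; rewrite -mpolyXD addSn addnC -mdegD; exact: form_X.
Qed.

Definition lin : {mpoly K[3]} := 'X_i0 + 'X_i1 - 'X_i2.

Lemma form_lin n f : form n f -> form n.+1 (lin * f).
Proof.
move=> hf; have h i : form n.+1 ('X_i * f).
  by have := @formMX n f U_(i)%MM hf; rewrite mdeg1 addn1.
by rewrite mulrBl mulrDl; apply: formD; [apply: formD|apply: formN].
Qed.

Lemma lin_neq0 : lin != 0.
Proof.
apply/eqP => /(congr1 (mcoeff U_(i0)%MM)).
rewrite mcoeffB mcoeffD !mcoeffXU mcoeff0 /= subr0 addr0 => /eqP.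
by rewrite oner_eq0.
Qed.

(* Reduction modulo [lin], dehomogenised at y = 1. *)
Definition restrict : {rmorphism {mpoly K[3]} -> {poly K}} :=
  mmap (@polyC K) (fun i : 'I_3 => nth 0 [:: 'X; 1; 1 + 'X] i).

Lemma restrictZ c f : restrict (c *: f) = c *: restrict f.
Proof. by rewrite /restrict /= mmapZ mul_polyC. Qed.

Lemma restrict_Xi (i : 'I_3) : restrict 'X_i = nth 0 [:: 'X; 1; 1 + 'X] i.
Proof. by rewrite /restrict /= mmapX mmap1U. Qed.

Lemma restrict_monomial a b c : restrict 'X_[monomial a b c] = 'X^a * (1 + 'X) ^+ c.
Proof.
by rewrite mpolyX_monomial !rmorphM !rmorphXn /= !restrict_Xi /= expr1n mulr1.
Qed.

Lemma restrict_lin : restrict lin = 0.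
Proof. by rewrite rmorphB rmorphD /= !restrict_Xi /= ['X + 1]addrC subrr. Qed.

(** Homogenisation by y, without z: a section of [restrict] on polynomials of size at most [n]. *)
Definition lift_poly n q : {mpoly K[3]} :=
  \sum_(i < n) q`_i *: 'X_[monomial i (n - i.+1) 0].

Lemma lift_polyD n q r : lift_poly n (q + r) = lift_poly n q + lift_poly n r.
Proof. by rewrite /lift_poly -big_split; apply: eq_bigr => i _; rewrite coefD scalerDl. Qed.

Lemma lift_polyZ n c q : lift_poly n (c *: q) = c *: lift_poly n q.
Proof. by rewrite /lift_poly scaler_sumr; apply: eq_bigr => i _; rewrite coefZ scalerA. Qed.

Lemma lift_poly0 n : lift_poly n 0 = 0.
Proof. by rewrite /lift_poly big1 // => i _; rewrite coef0 scale0r. Qed.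

Lemma form_lift_poly n q : form n (lift_poly n q).
Proof.
apply: big_ind => [|u v|i _]; [exact: form_zero|exact: formD|apply: formZ].
by move: (@form_X (monomial i (n - i.+1) 0)); rewrite mdeg_monomial addn0 -addSn subnKC.
Qed.

Lemma restrict_lift_poly n q : restrict (lift_poly n q) = \poly_(i < n) q`_i.
Proof.
rewrite /lift_poly rmorph_sum poly_def; apply: eq_bigr => i _ /=.
by rewrite restrictZ restrict_monomial expr0 mulr1.
Qed.

(** Induction on the power of z, replacing one factor z by x + y - [lin]. *)
Lemma form_decomposition_monomial a b c : exists2 f', form (a + b + c) f' &
  'X_[monomial a b c] = lin * f' + lift_poly (a + b + c).+1 (restrict 'X_[monomial a b c]).
Proof.
elim: c a b => [|c IH] a b.
  exists 0; rewrite ?addn0; first exact: form_zero.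
  rewrite restrict_monomial expr0 mulr1 mulr0 add0r /lift_poly.
  have ha : (a < (a + b).+1)%N by rewrite ltnS leq_addr.
  rewrite (bigD1 (Ordinal ha)) //= coefXn eqxx scale1r subSS addKn big1 ?addr0 // => i.
  by rewrite -val_eqE /= coefXn => /negbTE ->; rewrite scale0r.
have [u hu eu] := IH a.+1 b; have [v hv ev] := IH a b.+1.
have e1 : (a.+1 + b + c = a + b + c.+1)%N by lia.
have e2 : (a + b.+1 + c = a + b + c.+1)%N by lia.
rewrite e1 in hu eu; rewrite e2 in hv ev.
have E : 'X_[monomial a b c.+1] = 'X_[monomial a.+1 b c] + 'X_[monomial a b.+1 c]
    - lin * 'X_[monomial a b c] :> {mpoly K[3]}.
  by rewrite !mpolyX_monomial !exprS /lin; ring.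
exists (u + v - 'X_[monomial a b c]).
  apply: formD; first exact: formD.
  by apply: formN; have := @form_X (monomial a b c); rewrite mdeg_monomial addnS.
rewrite {1}E {1}eu {1}ev.
have -> : restrict 'X_[monomial a b c.+1] =
    restrict 'X_[monomial a.+1 b c] + restrict 'X_[monomial a b.+1 c].
  by rewrite !restrict_monomial !exprS; ring.
by rewrite lift_polyD; ring.
Qed.

Lemma form_decomposition n f : form n f ->
  exists2 f', form n.-1 f' & f = lin * f' + lift_poly n (restrict f).
Proof.
move=> hf.
apply: (@monomial_ind (fun u => exists2 u', form n.-1 u' &
  u = lin * u' + lift_poly n (restrict u))).
- by exists 0; [exact: form_zero|rewrite mulr0 rmorph0 lift_poly0 addr0].
- move=> u v [u' hu eu] [v' hv ev]; exists (u' + v'); first exact: formD.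
  by rewrite {1}eu {1}ev rmorphD lift_polyD mulrDr addrACA.
- move=> c u [u' hu eu]; exists (c *: u'); first exact: formZ.
  by rewrite {1}eu restrictZ lift_polyZ -scalerAr scalerDr.
- move=> e /hf <-; rewrite [e]monomial_eta mdeg_monomial /=.
  exact: form_decomposition_monomial.
Qed.

Lemma size_restrict n f : form n f -> (size (restrict f) <= n)%N.
Proof.
case/form_decomposition=> f' _ {1}->.
by rewrite rmorphD rmorphM /= restrict_lin mul0r add0r restrict_lift_poly size_poly.
Qed.

Lemma restrict_eq0 n f : form n f -> restrict f = 0 ->
  exists2 f', form n.-1 f' & f = lin * f'.
Proof.
move=> /form_decomposition [f' hf' ef] e; exists f' => //.
by rewrite ef e lift_poly0 addr0.
Qed.

End Forms.

(** * The monomial ideal and multiplication by the linear form *)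

Section MonomialIdeal.
Variables (K : fieldType) (al be ga t : nat).
Implicit Types (f g u v : {mpoly K[3]}).

Let i0 : 'I_3 := @Ordinal 3 0 isT.
Let i1 : 'I_3 := @Ordinal 3 1 isT.
Let i2 : 'I_3 := @Ordinal 3 2 isT.

Let gens := acI_gens K al be ga t.

Let expand f1 f2 f3 f4 : {mpoly K[3]} :=
  'X_[monomial (al + t) 0 0] * f1 + 'X_[monomial 0 (be + t) 0] * f2 +
  'X_[monomial 0 0 (ga + t)] * f3 + 'X_[monomial al be ga] * f4.

Lemma in_acI f : in_span gens f <-> exists f1 f2 f3 f4, f = expand f1 f2 f3 f4.
Proof.
rewrite /expand !mpolyX_monomial !expr0 !mulr1 !mul1r; split.
  case=> c ->; rewrite !big_ord_recl big_ord0 /= addr0.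
  do 4 eexists; rewrite !addrA; congr (_ + _ + _ + _); exact: mulrC.
case=> f1 [f2 [f3 [f4 ->]]]; exists (fun i => nth 0 [:: f1; f2; f3; f4] i).
rewrite !big_ord_recl big_ord0 /= addr0 !addrA.
by congr (_ + _ + _ + _); rewrite mulrC.
Qed.

Definition in_acI_exponent (e : 'X_{1..3}) :=
  [|| al + t <= e i0, be + t <= e i1, ga + t <= e i2 |
      [&& al <= e i0, be <= e i1 & ga <= e i2]]%N.

Lemma mcoeffMX_neq0 (e e' : 'X_{1..3}) u : ('X_[e] * u)@_e' != 0 ->
  exists e'', e' = (e + e'')%MM.
Proof.
rewrite -mcoeff_msupp mulrC (perm_mem (msuppMX _ _)) => /mapP [e'' _ ->].
by exists e''.
Qed.

Lemma in_acI_coef f e : in_span gens f -> f@_e != 0 -> in_acI_exponent e.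
Proof.
move/in_acI=> [f1 [f2 [f3 [f4 ->]]]]; rewrite /expand !mcoeffD.
have addr_neq0 (a b : K) : a + b != 0 -> a != 0 \/ b != 0.
  by have [->|_] := eqVneq a 0; [rewrite add0r; right|left].
have exps a b c e'' : let e' := (monomial a b c + e'')%MM in
    [/\ a <= e' i0, b <= e' i1 & c <= e' i2]%N.
  have [e1 e2 e3] := monomialE a b c; rewrite /= !(mnmDE _ (monomial a b c)).
  by rewrite e1 e2 e3 !leq_addr.
case/addr_neq0=> [/addr_neq0 [/addr_neq0 []|]|] /mcoeffMX_neq0 [e'' ->];
  rewrite /in_acI_exponent.
- by have [-> _ _] := exps (al + t)%N 0%N 0%N e''.
- by have [_ -> _] := exps 0%N (be + t)%N 0%N e''; rewrite orbT.
- by have [_ _ ->] := exps 0%N 0%N (ga + t)%N e''; rewrite !orbT.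
- by have [-> -> ->] := exps al be ga e''; rewrite !orbT.
Qed.

(** Each monomial is divided by a generator, which makes the cofactors homogeneous; their degrees
    bound the sizes after restriction. A truncated difference 0 forces the cofactor to vanish. *)
Lemma form_in_acI n f : form n f -> (forall e, f@_e != 0 -> in_acI_exponent e) ->
  exists f1 f2 f3 f4, [/\ form (n - (al + t)) f1, form (n - (be + t)) f2,
    form (n - (ga + t)) f3, form (n - (al + be + ga)) f4 & f = expand f1 f2 f3 f4].
Proof.
move=> hf bad.
have z k : form k (0 : {mpoly K[3]}) by apply: form_zero.
apply: (@monomial_ind _ (fun u => exists f1 f2 f3 f4, [/\ form (n - (al + t)) f1,
  form (n - (be + t)) f2, form (n - (ga + t)) f3, form (n - (al + be + ga)) f4 &
  u = expand f1 f2 f3 f4])).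
- by exists 0, 0, 0, 0; rewrite /expand !mulr0 !addr0.
- move=> u v [u1 [u2 [u3 [u4 [? ? ? ? ->]]]]] [v1 [v2 [v3 [v4 [? ? ? ? ->]]]]].
  exists (u1 + v1), (u2 + v2), (u3 + v3), (u4 + v4).
  by split; [exact: formD..|rewrite /expand; ring].
- move=> c u [u1 [u2 [u3 [u4 [? ? ? ? ->]]]]].
  exists (c *: u1), (c *: u2), (c *: u3), (c *: u4).
  by split; [exact: formZ..|rewrite /expand !scalerDr -!scalerAr].
- move=> e fe; have := bad e fe; have := hf e fe.
  rewrite /in_acI_exponent [e]monomial_eta mdeg_monomial.
  have [-> -> ->] := monomialE (e i0) (e i1) (e i2).
  move: (e i0) (e i1) (e i2) => a b c <- {e fe}.
  have fX a' b' c' k : (a' + b' + c').+1 = k -> form k ('X_[monomial a' b' c'] : {mpoly K[3]}).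
    by move=> <-; rewrite -mdeg_monomial; apply: form_X.
  case/or4P => [h|h|h|/and3P [h1 h2 h3]].
  + exists 'X_[monomial (a - (al + t)) b c], 0, 0, 0; split=> //; first by apply: fX; lia.
    by rewrite /expand !mulr0 !addr0 -mpolyXD monomialD subnKC.
  + exists 0, 'X_[monomial a (b - (be + t)) c], 0, 0; split=> //; first by apply: fX; lia.
    by rewrite /expand !mulr0 !addr0 add0r -mpolyXD monomialD subnKC.
  + exists 0, 0, 'X_[monomial a b (c - (ga + t))], 0; split=> //; first by apply: fX; lia.
    by rewrite /expand !mulr0 !addr0 !add0r -mpolyXD monomialD subnKC.
  + exists 0, 0, 0, 'X_[monomial (a - al) (b - be) (c - ga)]; split=> //; first by apply: fX; lia.
    by rewrite /expand !mulr0 !add0r -mpolyXD monomialD !subnKC.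
Qed.

Section Lefschetz.
Variables (s m : nat).
Hypotheses (charK0 : [pchar K] =i pred0) (hs : (3 * s = al + be + ga)%N)
  (hab : (al <= be)%N) (hbc : (be <= ga)%N) (hc : (ga <= 2 * s)%N) (ha : (0 < al)%N)
  (ht : t = (s + m)%N)
  (hcase : ~~ odd m \/ [/\ odd m, al = be, be = ga & ~~ odd al]).

Let d := (2 * s + t)%N.

Lemma restrict_expand f1 f2 f3 f4 : restrict K (expand f1 f2 f3 f4) =
  combination al ga s m (restrict K f2) (restrict K f1) (restrict K f3) (restrict K f4).
Proof.
rewrite !rmorphD !rmorphM /= !restrict_monomial !expr0 !mul1r !mulr1 /combination -ht.
by rewrite [X in X + _ + _]addrC.
Qed.

(** Restricting [lin * f] gives a vanishing [combination] of cofactors within the size bounds. Hence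
    all cofactors restrict to 0, are divisible by [lin], and this factor cancels. *)
Lemma peak_injective f : form d.-1 f -> in_span gens (lin K * f) -> in_span gens f.
Proof.
move=> hf hI; have hlf := form_lin hf; rewrite prednK in hlf; last by rewrite /d; lia.
have [f1 [f2 [f3 [f4 [h1 h2 h3 h4 e]]]]] := form_in_acI hlf (fun e0 => in_acI_coef hI).
have /esym := congr1 (restrict K) e; rewrite rmorphM /= restrict_lin mul0r restrict_expand.
have size_le k n u : form k u -> k = n -> (size (restrict K u) <= n)%N.
  by move=> hu <-; apply: size_restrict.
case/(combination_eq0 hs hab hbc hc ha hcase charK0).
- by apply: size_le h2 _; rewrite /d; lia.
- by apply: size_le h1 _; rewrite /d; lia.
- by apply: size_le h3 _; rewrite /d; lia.
- by apply: size_le h4 _; rewrite /d; lia.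
move=> /(restrict_eq0 h2) [u2 _ e2] /(restrict_eq0 h1) [u1 _ e1].
move=> /(restrict_eq0 h3) [u3 _ e3] /(restrict_eq0 h4) [u4 _ e4].
apply/in_acI; exists u1, u2, u3, u4; apply: (mulfI (lin_neq0 K)).
by rewrite e e1 e2 e3 e4 /expand; ring.
Qed.

(** A monomial of [f] outside the ideal can be multiplied up to the peak degree d - 2 while staying
    outside, which contradicts [peak_injective] for the multiplied form. *)
Lemma injective_below n f : (n < d)%N -> form n f ->
  in_span gens (lin K * f) -> in_span gens f.
Proof.
move=> hn hf hI.
suff bad e : f@_e != 0 -> in_acI_exponent e.
  have [f1 [f2 [f3 [f4 [_ _ _ _ ef]]]]] := form_in_acI hf bad.
  by apply/in_acI; exists f1, f2, f3, f4.
move=> fe; have de := hf e fe; apply: contraT => nbad.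
have [e' [de' nbad']] : exists e', mdeg e' = (d.-1 - n)%N /\ ~~ in_acI_exponent (e + e')%MM.
  move: de nbad; rewrite /in_acI_exponent [e]monomial_eta mdeg_monomial.
  have [-> -> ->] := monomialE (e i0) (e i1) (e i2).
  move: (e i0) (e i1) (e i2) => a b c de nbad.
  suff [a' [b' [c' [H1 H2]]]] : exists a' b' c', (a' + b' + c' = d.-1 - n)%N /\
      ~~ [|| al + t <= a + a', be + t <= b + b', ga + t <= c + c' |
        [&& al <= a + a', be <= b + b' & ga <= c + c']]%N.
    exists (monomial a' b' c'); rewrite mdeg_monomial; split=> //.
    rewrite monomialD; have [-> -> ->] := monomialE (a + a') (b + b') (c + c').
    exact: H2.
  pose r := (d.-1 - n)%N.
  (* Keep an exponent that is below the hole, raise a second one to at most one less than its pure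
     power, and put the rest on the third. *)
  have [h|h] := ltnP a al.
    exists 0%N, (minn r (be + t - b.+1))%N, (r - minn r (be + t - b.+1))%N.
    rewrite /r /d; split; lia.
  have [h'|h'] := ltnP b be.
    exists (minn r (al + t - a.+1))%N, 0%N, (r - minn r (al + t - a.+1))%N.
    rewrite /r /d; split; lia.
  exists (minn r (al + t - a.+1))%N, (r - minn r (al + t - a.+1))%N, 0%N.
  by rewrite /r /d; split; lia.
have hI' : in_span gens ('X_[e'] * f).
  apply: peak_injective.
    by have := @formMX _ n f e' hf; rewrite de' subnKC //; lia.
  move/in_acI: hI => [f1 [f2 [f3 [f4 ef]]]]; apply/in_acI.
  exists ('X_[e'] * f1), ('X_[e'] * f2), ('X_[e'] * f3), ('X_[e'] * f4).
  by rewrite mulrCA ef /expand; ring.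
case/negP: nbad'; apply: (in_acI_coef hI').
by rewrite addmC mulrC mcoeffMX.
Qed.

(** It suffices to treat a monomial. A factor of degree d - 1 is congruent to a multiple of [lin]
    modulo the ideal by [combination_surj], and the complementary factor is multiplied back. *)
Lemma surjective_above n f : (d <= n)%N -> form n f ->
  exists2 f', form n.-1 f' & in_span gens (f - lin K * f').
Proof.
move=> hn hf.
apply: (@monomial_ind _ (fun u => exists2 u', form n.-1 u' & in_span gens (u - lin K * u'))).
- exists 0; first exact: form_zero.
  by apply/in_acI; exists 0, 0, 0, 0; rewrite /expand !mulr0 !addr0 subr0.
- move=> u v [u' hu /in_acI [u1 [u2 [u3 [u4 eu]]]]] [v' hv /in_acI [v1 [v2 [v3 [v4 ev]]]]].
  exists (u' + v'); first exact: formD.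
  apply/in_acI; exists (u1 + v1), (u2 + v2), (u3 + v3), (u4 + v4).
  by rewrite mulrDr opprD addrACA eu ev /expand; ring.
- move=> c u [u' hu /in_acI [u1 [u2 [u3 [u4 eu]]]]]; exists (c *: u'); first exact: formZ.
  apply/in_acI; exists (c *: u1), (c *: u2), (c *: u3), (c *: u4).
  by rewrite -scalerAr -scalerBr eu /expand !scalerDr -!scalerAr.
move=> e fe; have de := hf e fe.
have [e1 [e2 [ee de1]]] : exists e1 e2, e = (e1 + e2)%MM /\ (mdeg e1).+1 = d.
  move: de; rewrite [e]monomial_eta mdeg_monomial.
  move: (e i0) (e i1) (e i2) => a b c de.
  pose a' := minn a d.-1; pose b' := minn b (d.-1 - a'); pose c' := (d.-1 - a' - b')%N.
  exists (monomial a' b' c'), (monomial (a - a') (b - b') (c - c')).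
  rewrite monomialD mdeg_monomial; split.
    by congr monomial; rewrite /c' /b' /a' /d; lia.
  by rewrite /c' /b' /a' /d; lia.
have hX : form d ('X_[e1] : {mpoly K[3]}) by rewrite -de1; apply: form_X.
have sX : (size (restrict K 'X_[e1]) <= (2 * s - be) + (2 * s - al) + (2 * s - ga) + m)%N.
  by apply: leq_trans (size_restrict hX) _; rewrite /d; lia.
have [q2 [q1 [q3 [q4 [s2 s1 s3 s4 eq]]]]] :=
  combination_surj hs hab hbc hc ha hcase charK0 sX.
(* An element of the ideal with the same restriction as the monomial of exponent [e1], so that the
   difference is divisible by [lin]. *)
pose u := expand (lift_poly (2 * s - al) q1) (lift_poly (2 * s - be) q2)
  (lift_poly (2 * s - ga) q3) (lift_poly m q4).
have trunc k (q : {poly K}) : (size q <= k)%N -> \poly_(i < k) q`_i = q.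
  move=> sq; apply/polyP => i; rewrite coef_poly; case: ltnP => // hi.
  by rewrite nth_default // (leq_trans sq).
have hu : form d u.
  have hM a b c k q : (k + (a + b + c) = d)%N ->
      form d ('X_[monomial a b c] * lift_poly k q).
    move=> <-; rewrite -mdeg_monomial; apply: formMX; exact: form_lift_poly.
  by rewrite /u /expand; apply: formD; [apply: formD; [apply: formD|]|]; apply: hM; rewrite /d; lia.
have [] := @restrict_eq0 K d ('X_[e1] - u).
- by apply: formD => //; apply: formN.
- rewrite rmorphB /u restrict_expand !restrict_lift_poly !trunc //.
  by rewrite [restrict K _]eq subrr.
move=> g hg eg; exists ('X_[e2] * g).
  have := @formMX _ d.-1 g e2 hg; congr form.
  by rewrite -de ee mdegD -de1.
apply/in_acI; exists ('X_[e2] * lift_poly (2 * s - al) q1), ('X_[e2] * lift_poly (2 * s - be) q2),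
  ('X_[e2] * lift_poly (2 * s - ga) q3), ('X_[e2] * lift_poly m q4).
transitivity ('X_[e2] * u); last by rewrite /u /expand; ring.
rewrite ee mpolyXD mulrCA -eg; ring.
Qed.

End Lefschetz.
End MonomialIdeal.

(* The weak Lefschetz property of the quotient *)
Local Close Scope ring_scope.

Theorem proposition10p14 (K : fieldType) (charK0 : [pchar K]%R =i pred0)
    (alpha beta gamma t : nat)
    (ha : 0 < alpha) (hab : alpha <= beta) (hbc : beta <= gamma)
    (hc : gamma <= 2 * (alpha + beta))
    (ht : alpha + beta + gamma <= 3 * t)
    (h3 : 3 %| alpha + beta + gamma) :
  odd t = odd (alpha + beta + gamma) \/
  [/\ odd t, alpha = beta, beta = gamma & ~~ odd alpha] ->
  weak_Lefschetz (@quot_piece K 3 (acI K t ha hab hbc)).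
Proof.
move=> hpar; case/dvdnP: h3 => s es; rewrite mulnC in es.
pose m := (t - s)%N; have et : t = (s + m)%N by rewrite /m; lia.
have hs2 : (gamma <= 2 * s)%N by lia.
(* The sum 3s has the parity of [s], so (i) says that t - s is even; in (ii), s = alpha is even and
   [t] odd, so [m] is odd. *)
have hcase : ~~ odd m \/ [/\ odd m, alpha = beta, beta = gamma & ~~ odd alpha].
  case: hpar => [hp|[h1 h2 h4 h5]]; [left|right; split=> //]; lia.
have eqE f g : \pi_{ideal_quot (acI K t ha hab hbc)}%qT f = \pi%qT g <->
    in_span (acI_gens K alpha beta gamma t) (f - g).
  split=> [/eqP|h]; last by apply/eqP; rewrite -Quotient.idealrBE; apply/asboolP.
  by rewrite -Quotient.idealrBE => /asboolP.
exists (\pi%qT (lin K)).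
  exists (lin K) => //; apply/form_dhomog.
  by have := form_lin (@form_X K 0%MM); rewrite mpolyX0 mulr1 mdeg0.
(* Degree [j] is [form j.+1]: the map from degree [j] is injective up to the peak j = d - 2 and
   surjective beyond it. *)
move=> j; have [hj|hj] := ltnP j.+1 (2 * s + t); [left|right].
  move=> _ _ [f hf ->] [g hg ->]; rewrite -!rmorphM => /eqE; rewrite -mulrBr => hI.
  apply/eqE; apply: (injective_below charK0 (esym es) hab hbc hs2 ha et hcase hj _ hI).
  by apply: formD; [|apply: formN]; apply/form_dhomog.
move=> _ [f hf ->]; move/form_dhomog: hf => hf.
have [f' hf' hI] := surjective_above charK0 (esym es) hab hbc hs2 ha et hcase (leqW hj) hf.
exists (\pi%qT f'); first by exists f' => //; apply/form_dhomog.
by rewrite -rmorphM; apply/esym/eqE.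
Qed.
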